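(* Let $\mathcal G$ be a connected matrix Lie group with Lie algebra $\mathfrak g$ and a nondegenerate bi-invariant symmetric bilinear form $\langle,\rangle$ on $\mathfrak g$. Let $\mathcal A$ be a connected Lie subgroup of $\mathcal G$ with Lie algebra $\mathfrak a\subset\mathfrak g$ such that $\langle,\rangle$ restricted to $\mathfrak a$ is nondegenerate, let $\mathcal B$ be an invertible intertwining operator on $\mathfrak a$, let $\beta_0\neq0$ be real, $\vec\beta=(\beta_0,\mathcal B)$, and equip $\mathcal G$ with the left-invariant metric induced by $$\langle\mathtt X_1,\mathtt X_2\rangle_{\vec\beta}:=\beta_0\langle\mathtt X_1,\mathtt X_2\rangle-\langle(\mathcal B+\beta_0I_{\mathfrak a})\mathcal P_{\mathfrak a}\mathtt X_1,\mathcal P_{\mathfrak a}\mathtt X_2\rangle,\qquad \mathtt X_1,\mathtt X_2\in\mathfrak g.$$ Then the Christoffel function (of the Levi-Civita connection) of two tangent vectors $\xi,\eta$ at $X\in\mathcal G$ is $$\Gamma(\xi,\eta)=-\tfrac12(\xi X^{-1}\eta+\eta X^{-1}\xi)+\tfrac12X\Big([(I_{\mathfrak a}+\beta_0^{-1}\mathcal B)\mathcal P_{\mathfrak a}(X^{-1}\xi),X^{-1}\eta]+[(I_{\mathfrak a}+\beta_0^{-1}\mathcal B)\mathcal P_{\mathfrak a}(X^{-1}\eta),X^{-1}\xi]\Big).$$ The geodesic starting at $X\in\mathcal G$ with initial velocity $\xi\in T_X\mathcal G$ is $$\gamma(t)=X\operatorname{expm}\!\Big(t\big(-(I_{\mathfrak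 a}+\beta_0^{-1}\mathcal B)\mathcal P_{\mathfrak a}(X^{-1}\xi)+X^{-1}\xi\big)\Big)\operatorname{expm}\!\Big(t(I_{\mathfrak a}+\beta_0^{-1}\mathcal B)\mathcal P_{\mathfrak a}(X^{-1}\xi)\Big).$$ Set $\mathtt V=X^{-1}\xi$ and let $\eta\in T_X\mathcal G$ be another tangent vector. Then the parallel transport of $\eta$ along the geodesic $\gamma$ with initial point and velocity $(X,\xi)$, from time $0$ to $t$, is $$\mathtt T(\gamma)_0^t\eta=X\operatorname{expm}\!\Big(t\big(-(I_{\mathfrak a}+\beta_0^{-1}\mathcal B)\mathcal P_{\mathfrak a}\mathtt V+\mathtt V\big)\Big)\operatorname{expv}(t\mathrm P_{\mathtt V},X^{-1}\eta)\operatorname{expm}\!\Big(t(I_{\mathfrak a}+\beta_0^{-1}\mathcal B)\mathcal P_{\mathfrak a}\mathtt V\Big),$$ where for $\mathtt B\in\mathfrak g$ $$\mathrm P_{\mathtt V}:\mathtt B\mapsto\tfrac12\Big([\mathtt B,\mathtt V]+[(I_{\mathfrak a}+\beta_0^{-1}\mathcal B)\mathcal P_{\mathfrak a}\mathtt V,\mathtt B]-[(I_{\mathfrak a}+\beta_0^{-1}\mathcal B)\mathcal P_{\mathfrak a}\mathtt B,\mathtt V]\Big).$$ The map $\mathrm P_{\mathtt V}$ is antisymmetric in $\langle,\rangle_{\vec\beta}$: $\langle\mathrm P_{\mathtt V}\mathtt B,\mathtt C\rangle_{\vec\beta}+\langle\mathrm P_{\mathtt V}\mathtt C,\mathtt B\rangle_{\vec\beta}=0$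 for $\mathtt V,\mathtt B,\mathtt C\in\mathfrak g$.
   Context: A matrix Lie group is a Lie subgroup of some $\mathrm{GL}(N)$, with $T_X\mathcal G=X\mathfrak g$. The form $\langle,\rangle$ is bi-invariant if it is $\operatorname{Ad}$-invariant, equivalently (connected group) $\langle\mathtt A,[\mathtt B,\mathtt C]\rangle=\langle\mathtt B,[\mathtt C,\mathtt A]\rangle=\langle\mathtt C,[\mathtt A,\mathtt B]\rangle$. An intertwining operator on $\mathfrak a$ is a linear operator $\mathcal B:\mathfrak a\to\mathfrak a$, symmetric with respect to $\langle,\rangle$, such that $(\mathtt A_1,\mathtt A_2)\mapsto\langle\mathtt A_1,\mathcal B\mathtt A_2\rangle$ is bi-invariant on $\mathfrak a$. $I_{\mathfrak a}$ is the identity of $\mathfrak a$; $\mathcal P_{\mathfrak a}:\mathfrak g\to\mathfrak a$ is the $\langle,\rangle$-orthogonal projection. The induced left-invariant (pseudo-Riemannian) metric is $\langle\xi,\eta\rangle_X=\langle X^{-1}\xi,X^{-1}\eta\rangle_{\vec\beta}$. The Christoffel function $\Gamma$ is defined by $\nabla_{\mathtt Y}\mathtt Z=\mathrm D_{\mathtt Y}\mathtt Z+\Gamma(\mathtt Y,\mathtt Z)$, where $\nabla$ is the Levi-Civita connection, vector fields are regarded as matrix-valued functions and $\mathrm D_{\mathtt Y}$ is the directional derivative. $[\cdot,\cdot]$ is the matrix commutator, $\operatorname{expm}$ the matrix exponential, and $\operatorname{expv}(t\mathrm P,v)=e^{t\mathrm P}v$ for a linear operator $\mathrm P$ on a matrix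 space and an element $v$. *)

(* Defs.v *)
From HB Require Import structures.
From mathcomp Require Import all_boot all_order all_algebra.
From mathcomp Require Import all_classical all_reals all_analysis.

Set Implicit Arguments.
Unset Strict Implicit.
Unset Printing Implicit Defensive.

Import Order.TTheory GRing.Theory Num.Theory.
Import numFieldNormedType.Exports.

Local Open Scope classical_set_scope.
Local Open Scope ring_scope.

Section MatrixFunctions.
Context {R : realType} {N : nat}.
Implicit Types (A C : 'M[R]_N).

Definition mxbr A C : 'M[R]_N := A *m C - C *m A.

Definition expm A : 'M[R]_N := limn (series (fun k => k`!%:R^-1 *: A ^+ k)).

(* expv P v is e^P v for an operator P on a space of matrices. *)
Definition expv (P : 'M[R]_N -> 'M[R]_N) (v : 'M[R]_N) : 'M[R]_N :=
  limn (series (fun k => k`!%:R^-1 *: iter k P v)).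

End MatrixFunctions.

Section LieSubgroups.
Context {R : realType} {N : nat}.
Variables (G : set 'M[R]_N) (g : {vspace 'M[R]_N}).

(* The Lie group topology of G, which may be finer than the one induced by
   'M[R]_N when G is not closed in GL(N): the sets X expm(U), U a neighbourhood
   of 0 in g, form a basis of neighbourhoods of X. *)
Definition lie_open (O : set 'M[R]_N) :=
  forall X, O X -> \forall A \near (0 : 'M[R]_N), A \in g -> O (X *m expm A).

(* G is a connected, not necessarily closed, Lie subgroup of GL(N) with Lie
   algebra g = {A | expm(tA) is in G for all t}; its charts are the
   exponential coordinates A |-> X expm(A), A in g near 0. *)
Record connected_lie_subgroup : Prop := ConnectedLieSubgroup {
  lie_unit : forall X, G X -> X \in unitmx;
  lie_1 : G 1%:M;
  lie_mul : forall X Y, G X -> G Y -> G (X *m Y);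
  lie_inv : forall X, G X -> G (invmx X);
  lie_algE : forall A, (A \in g) <-> (forall t : R, G (expm (t *: A)));
  lie_br : forall A C, A \in g -> C \in g -> mxbr A C \in g;
  lie_connected : forall O : set 'M[R]_N, O `<=` G -> O !=set0 ->
    lie_open O -> lie_open (G `\` O) -> O = G }.

Definition tangent (X : 'M[R]_N) : set 'M[R]_N := [set X *m A | A in [set` g]].

(* Derivative at X of a function on G along the tangent vector xi, computed
   along the curve t |-> X expm(t X^-1 xi) of G. *)
Definition dirD (V : normedModType R) (f : 'M[R]_N -> V) (X xi : 'M[R]_N) : V :=
  derive1 (fun t : R => f (X *m expm (t *: (invmx X *m xi)))) 0.

(* f in the exponential chart at X; precomposing with the projection of
   'M[R]_N onto g (along any complement) encodes a map defined on g. *)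
Definition in_chart (V : normedModType R) (f : 'M[R]_N -> V) (X : 'M[R]_N) :
    'M[R]_N -> V :=
  fun A => f (X *m expm (projv g A)).

(* C^k functions on the manifold G; only the values of f on G matter.  The
   left-invariant fields X |-> X A, A in g, span every tangent space, so f is
   C^(k+1) iff it is differentiable at every point and its derivatives along
   these fields are C^k. *)
Fixpoint Ck_on (k : nat) (V : normedModType R) (f : 'M[R]_N -> V) : Prop :=
  match k with
  | 0 => forall X, G X -> {for 0, continuous (in_chart f X)}
  | k'.+1 => (forall X, G X -> differentiable (in_chart f X) 0) /\
             (forall A, A \in g -> Ck_on k' (fun X => dirD f X (X *m A)))
  end.

Definition smooth_on (V : normedModType R) (f : 'M[R]_N -> V) :=
  forall k, Ck_on k f.

Definition vector_field (Y : 'M[R]_N -> 'M[R]_N) :=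
  smooth_on Y /\ forall X, G X -> tangent X (Y X).

(* Affine connections on G.  A vector field on G is represented by any function
   on 'M[R]_N extending it, whence the first axiom. *)
Record affine_connection
    (nabla : ('M[R]_N -> 'M[R]_N) -> ('M[R]_N -> 'M[R]_N) -> 'M[R]_N -> 'M[R]_N) :
    Prop := AffineConnection {
  conn_ext : forall Y Y' Z Z',
    vector_field Y -> vector_field Y' -> vector_field Z -> vector_field Z' ->
    {in G, Y =1 Y'} -> {in G, Z =1 Z'} -> {in G, nabla Y Z =1 nabla Y' Z'};
  conn_field : forall Y Z,
    vector_field Y -> vector_field Z -> vector_field (nabla Y Z);
  conn_linear : forall (f : 'M[R]_N -> R^o) Y Y' Z, smooth_on f ->
    vector_field Y -> vector_field Y' -> vector_field Z ->
    {in G, nabla (fun X => f X *: Y X + Y' X) Z =1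
           fun X => f X *: nabla Y Z X + nabla Y' Z X};
  conn_add : forall Y Z Z',
    vector_field Y -> vector_field Z -> vector_field Z' ->
    {in G, nabla Y (fun X => Z X + Z' X) =1
           fun X => nabla Y Z X + nabla Y Z' X};
  conn_leibniz : forall (f : 'M[R]_N -> R^o) Y Z, smooth_on f ->
    vector_field Y -> vector_field Z ->
    {in G, nabla Y (fun X => f X *: Z X) =1
           fun X => dirD f X (Y X) *: Z X + f X *: nabla Y Z X} }.

(* The Lie bracket of vector fields regarded as matrix-valued functions is
   [Y, Z] = D_Y Z - D_Z Y. *)
Record levi_civita (metric : 'M[R]_N -> 'M[R]_N -> 'M[R]_N -> R)
    (nabla : ('M[R]_N -> 'M[R]_N) -> ('M[R]_N -> 'M[R]_N) -> 'M[R]_N -> 'M[R]_N) :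
    Prop := LeviCivita {
  lc_connection : affine_connection nabla;
  lc_torsion_free : forall Y Z, vector_field Y -> vector_field Z ->
    {in G, forall X,
       nabla Y Z X - nabla Z Y X = dirD Z X (Y X) - dirD Y X (Z X)};
  lc_metric : forall Y Z W,
    vector_field Y -> vector_field Z -> vector_field W ->
    {in G, forall X,
       dirD (fun X' => metric X' (Z X') (W X') : R^o) X (Y X) =
       metric X (nabla Y Z X) (W X) + metric X (Z X) (nabla Y W X)} }.

Definition christoffel
    (nabla : ('M[R]_N -> 'M[R]_N) -> ('M[R]_N -> 'M[R]_N) -> 'M[R]_N -> 'M[R]_N)
    (Gam : 'M[R]_N -> 'M[R]_N -> 'M[R]_N -> 'M[R]_N) :=
  forall Y Z, vector_field Y -> vector_field Z ->
  {in G, forall X, nabla Y Z X = dirD Z X (Y X) + Gam X (Y X) (Z X)}.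

Definition smooth_curve (c : R -> 'M[R]_N) :=
  forall (k : nat) (t : R), derivable (derive1n k c) t 1.

(* Tangency to G is part of smoothness as a curve in the immersed manifold G. *)
Definition curve_on (c : R -> 'M[R]_N) :=
  smooth_curve c /\ forall t, G (c t) /\ tangent (c t) (derive1 c t).

(* Covariant derivative along c of a field W along c, for the connection with
   Christoffel function Gam. *)
Definition covD (Gam : 'M[R]_N -> 'M[R]_N -> 'M[R]_N -> 'M[R]_N)
    (c W : R -> 'M[R]_N) (t : R) : 'M[R]_N :=
  derive1 W t + Gam (c t) (derive1 c t) (W t).

Definition geodesic (Gam : 'M[R]_N -> 'M[R]_N -> 'M[R]_N -> 'M[R]_N)
    (c : R -> 'M[R]_N) :=
  curve_on c /\ forall t, covD Gam c (derive1 c) t = 0.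

Definition parallel (Gam : 'M[R]_N -> 'M[R]_N -> 'M[R]_N -> 'M[R]_N)
    (c W : R -> 'M[R]_N) :=
  [/\ smooth_curve W, forall t, tangent (c t) (W t)
    & forall t, covD Gam c W t = 0].

(* zeta is the parallel transport of eta along c from time s to time t. *)
Definition parallel_transport
    (Gam : 'M[R]_N -> 'M[R]_N -> 'M[R]_N -> 'M[R]_N)
    (c : R -> 'M[R]_N) (s t : R) (eta zeta : 'M[R]_N) :=
  exists W, [/\ parallel Gam c W, W s = eta & W t = zeta].

End LieSubgroups.

Section Forms.
Context {R : realType} {N : nat}.
Implicit Types (h : {vspace 'M[R]_N}) (f : 'M[R]_N -> 'M[R]_N -> R).

(* Only the values of f on h are constrained. *)
Definition symmetric_bilinear h f :=
  [/\ forall k A B C, A \in h -> B \in h -> C \in h ->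
        f (k *: A + B) C = k * f A C + f B C
    & forall A B, A \in h -> B \in h -> f A B = f B A].

Definition nondegenerate_on h f :=
  forall A, A \in h -> (forall B, B \in h -> f A B = 0) -> A = 0.

Definition bi_invariant (H : set 'M[R]_N) h f :=
  forall X A B, H X -> A \in h -> B \in h ->
  f (X *m A *m invmx X) (X *m B *m invmx X) = f A B.

Record intertwining (H : set 'M[R]_N) h f (B : 'M[R]_N -> 'M[R]_N) : Prop :=
  Intertwining {
  itw_stable : forall A, A \in h -> B A \in h;
  itw_linear : forall k A C, A \in h -> C \in h -> B (k *: A + C) = k *: B A + B C;
  itw_sym : forall A C, A \in h -> C \in h -> f (B A) C = f A (B C);
  itw_bi_invariant : bi_invariant H h (fun A C => f A (B C)) }.

(* Unique on the space where f is defined if f is nondegenerate on h. *)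
Definition orth_proj h f (A : 'M[R]_N) : 'M[R]_N :=
  xget 0 [set P | P \in h /\ forall C, C \in h -> f (A - P) C = 0].

Definition form_beta h f (beta0 : R) (B : 'M[R]_N -> 'M[R]_N) (A C : 'M[R]_N) : R :=
  beta0 * f A C
  - f (B (orth_proj h f A) + beta0 *: orth_proj h f A) (orth_proj h f C).

Definition left_invariant_metric f (X xi eta : 'M[R]_N) : R :=
  f (invmx X *m xi) (invmx X *m eta).

(* (I + beta0^-1 B) o P, with P the orthogonal projection onto h. *)
Definition IBP h f (beta0 : R) (B : 'M[R]_N -> 'M[R]_N) (A : 'M[R]_N) : 'M[R]_N :=
  orth_proj h f A + beta0^-1 *: B (orth_proj h f A).

End Forms.

(* Main.v *)
Require Import Defs.
From HB Require Import structures.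
From mathcomp Require Import all_boot all_order all_algebra.
From mathcomp Require Import perm.
From mathcomp Require Import all_classical all_reals all_analysis.
Import Order.TTheory GRing.Theory Num.Theory.
Import numFieldNormedType.Exports.
Local Open Scope classical_set_scope.
Local Open Scope ring_scope.
Set Implicit Arguments.
Unset Strict Implicit.
Unset Printing Implicit Defensive.

(** Left translation turns everything into algebra on g.  Write a vector field
    as Z X = X z(X), with z taking values in g, and phi = (I + beta0^-1 B) P.

    The metric.  Since P is the orthogonal projection, phi is self-adjoint for
    the bi-invariant form <,> and the given metric is beta0 <(1 - phi) x, y> on
    g ([form_betaE]); it is nondegenerate because B is injective ([phi_fix0]).
    The second structural fact is that phi commutes with Ad_h for h in the
    subgroup A ([phi_Ad]): P does because Ad_h preserves <,> and a, and B does
    because x, y |-> <x, B y> is bi-invariant on a.  Differentiating, phi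
    commutes with ad_n for n in a ([phi_ad]), in particular for n = phi x.

    The connection.  With
      S x y = ([x, y] + [phi x, y] + [phi y, x]) / 2
    the operation nabla_Y Z = X (D_Y z + S y z) is torsion free because
    S x y - S y x = [x, y], and it is metric because every S x is antisymmetric
    for the metric ([conn_op_skew]).  Rewriting D_Y Z = X (y z + D_Y z) shows
    that its Christoffel function is X (S y z - y z), which is the formula of
    the theorem.  Uniqueness is the usual argument: the difference of two
    Levi-Civita connections, paired with a third field, is symmetric in the
    first two arguments and antisymmetric in the last two, hence zero
    ([levi_civita_unique]).

    Geodesics and transport.  Along a curve c with v = c^-1 c', a field c w is
    parallel iff w' = - S v w.  For a geodesic this is v' = [v, phi v], and
    applying phi gives (phi v)' = [phi v, phi v] = 0: n = phi v is
    constant, so v' = [v, n] is linear with constant coefficients, and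
    v = Ad_(exp (-t n)) V.  Then (c exp (-t n))' = c exp (-t n) (V - n), which
    integrates to the product of two exponentials ([geodesic_unique]).  In the
    frame Ad_(exp (-t n)) the equation of parallel transport becomes E' = P_V E,
    again with constant coefficients ([along_parallel]), hence the operator
    exponential.  No existence theorem for differential equations is involved:
    solutions are explicit, and uniqueness follows by differentiating the
    product of an unknown solution with an inverse exponential
    ([right_ode_unique]). *)

(** * Differential calculus of matrix-valued functions *)

Section LinearAlgebraCalculus.
Context {R : realType}.

(** A curve is differentiated through its Fréchet differential, so that the chain
    rule for [is_diff] gives the product rules below. *)
Lemma is_derive_is_diff (V : normedModType R) (f : R -> V) (t : R) df :
  is_derive t (1 : R) f df <-> is_diff t f ( *:%R^~ df).
Proof.
split=> [Df|Df].
- have [Hf <-] := Df.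
  have Hd : differentiable f t by apply/derivable1_diffP.
  by apply: DiffDef => //; rewrite deriv1E// derive1E.
- have Hd : differentiable f t by case: Df.
  apply: DeriveDef; first exact/derivable1_diffP.
  by rewrite deriveE// diff_val scale1r.
Qed.

Lemma is_derive_derive1 (V : normedModType R) (f : R -> V) (t : R) df :
  is_derive t (1 : R) f df -> derive1 f t = df.
Proof. by move=> Df; rewrite derive1E derive_val. Qed.

Lemma derivable_derive1 (V : normedModType R) (f : R -> V) (t : R) :
  derivable f t 1 -> is_derive t (1 : R) f (derive1 f t).
Proof. by rewrite derive1E; exact: derivableP. Qed.

Lemma mx_linear_continuous m n (V : normedModType R)
  (L : {linear 'M[R]_(m, n) -> V}) : continuous L.
Proof.
have -> : (L : _ -> _) = \sum_i \sum_j (fun A => A i j *: L (delta_mx i j)).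
  apply/funext => A; rewrite {1}(matrix_sum_delta A) linear_sum fct_sumE.
  apply: eq_bigr => i _; rewrite linear_sum fct_sumE.
  by apply: eq_bigr => j _; rewrite linearZ.
move=> A; elim/big_ind : _ => [|f g Cf Cg|i _]; [exact: cst_continuous|exact: continuousD|].
elim/big_ind : _ => [|f g Cf Cg|j _]; [exact: cst_continuous|exact: continuousD|].
apply: (@continuous_comp _ _ _ (fun A : 'M[R]_(m, n) => A i j : R^o) ( *:%R^~ (L (delta_mx i j)))).
  exact: coord_continuous.
exact: scalel_continuous.
Qed.

Lemma is_diff_linear (U V : normedModType R) (L : {linear U -> V}) x :
  continuous L -> is_diff x L L.
Proof.
by move=> cL; apply: DiffDef; [exact: linear_differentiable|exact: diff_lin].
Qed.

Lemma is_diff_mx_linear m n (V : normedModType R)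
  (L : {linear 'M[R]_(m, n) -> V}) x : is_diff x L L.
Proof. exact/is_diff_linear/mx_linear_continuous. Qed.

Lemma is_derive_linear (U V : normedModType R) (L : {linear U -> V}) (f : R -> U) (t : R) df :
  continuous L -> is_derive t (1 : R) f df -> is_derive t (1 : R) (L \o f) (L df).
Proof.
move=> cL /is_derive_is_diff Df; apply/is_derive_is_diff.
have DL := is_diff_linear (f t) cL.
apply: is_diff_eq.
by apply/funext => h /=; rewrite linearZ.
Qed.

Lemma is_diff_bilin (X U V W : normedModType R) (b : {bilinear U -> V -> W})
    (f df : X -> U) (g dg : X -> V) x :
  continuous (fun p => b p.1 p.2) -> is_diff x f df -> is_diff x g dg ->
  is_diff x (fun y => b (f y) (g y)) (fun h => b (f x) (dg h) + b (df h) (g x)).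
Proof.
move=> cb Df Dg.
have Db : is_diff (f x, g x) (fun q => b q.1 q.2)
    (fun q => b (f x) q.2 + b q.1 (g x)).
  by apply: DiffDef; [exact: differentiable_bilin|rewrite diff_bilin].
exact: (@is_diff_comp _ _ _ _ (fun y => (f y, g y)) _ (fun q => b q.1 q.2)).
Qed.

Lemma is_derive_bilin (U V W : normedModType R) (b : {bilinear U -> V -> W})
    (f : R -> U) (g : R -> V) (t : R) df dg :
  continuous (fun p => b p.1 p.2) -> is_derive t (1 : R) f df -> is_derive t (1 : R) g dg ->
  is_derive t (1 : R) (fun s => b (f s) (g s)) (b (f t) dg + b df (g t)).
Proof.
move=> cb /is_derive_is_diff Df /is_derive_is_diff Dg; apply/is_derive_is_diff.
apply: is_diff_eq (is_diff_bilin cb Df Dg) _.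
by apply/funext => h; rewrite linearZr linearZl_LR scalerDr.
Qed.

(** Expanding the first argument in the standard basis reduces joint continuity
    to that of the linear maps b E_ij. *)
Lemma mx_bilinear_continuous m n p q (V : normedModType R)
  (b : {bilinear 'M[R]_(m, n) -> 'M[R]_(p, q) -> V}) :
  continuous (fun z => b z.1 z.2).
Proof.
have -> : (fun z => b z.1 z.2) =
    \sum_i \sum_j
      (fun z : 'M[R]_(m, n) * 'M[R]_(p, q) => z.1 i j *: b (delta_mx i j) z.2).
  apply/funext => z; rewrite {1}(matrix_sum_delta z.1) linear_sumlz fct_sumE.
  apply: eq_bigr => i _; rewrite linear_sumlz fct_sumE.
  by apply: eq_bigr => j _; rewrite linearZl_LR.
move=> z; elim/big_ind : _ => [|f g Cf Cg|i _]; [exact: cst_continuous|exact: continuousD|].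
elim/big_ind : _ => [|f g Cf Cg|j _]; [exact: cst_continuous|exact: continuousD|].
apply: (@cvgZ _ _ _ (nbhs z) _ (fun z => (z : 'M[R]_(m, n) * 'M[R]_(p, q)).1 i j) (fun z => b _ z.2)).
  apply: (@continuous_comp _ _ _ fst (fun A : 'M[R]_(m, n) => A i j)).
    exact: cvg_fst.
  exact: coord_continuous.
apply: (@continuous_comp _ _ _ snd (b (delta_mx i j))).
  exact: cvg_snd.
exact: mx_linear_continuous.
Qed.

(** A constant with head symbol is needed to carry the bilinear structure: scaling
    by a variable scalar is then covered by the product rule for bilinear maps. *)
Definition scaleop (V : normedModType R) (k : R^o) (v : V) : V := k *: v.

Lemma scaleop_is_bilinear (V : normedModType R) : bilinear_for
  (GRing.Scale.Law.clone _ _ *:%R _) (GRing.Scale.Law.clone _ _ *:%R _)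
  (@scaleop V).
Proof.
split=> [v|k] c x y; rewrite /scaleop/=; first by rewrite scalerDl scalerA.
by rewrite scalerDr !scalerA mulrC.
Qed.

HB.instance Definition _ (V : normedModType R) :=
  bilinear_isBilinear.Build R R^o V V _ _ (@scaleop V) (scaleop_is_bilinear V).

Lemma is_derive_mulmx m n p (f : R -> 'M[R]_(m, n)) (g : R -> 'M[R]_(n, p))
    (t : R) df dg :
  is_derive t (1 : R) f df -> is_derive t (1 : R) g dg ->
  is_derive t (1 : R) (fun s => f s *m g s) (f t *m dg + df *m g t).
Proof. by apply: is_derive_bilin; exact: mx_bilinear_continuous. Qed.

Lemma is_derive_mulmxl m n p (A : 'M[R]_(m, n)) (g : R -> 'M[R]_(n, p)) (t : R) dg :
  is_derive t (1 : R) g dg -> is_derive t (1 : R) (fun s => A *m g s) (A *m dg).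
Proof. by apply: (is_derive_linear (L := mulmx A)); exact: mx_linear_continuous. Qed.

Lemma is_derive_mulmxr m n p (A : 'M[R]_(n, p)) (f : R -> 'M[R]_(m, n)) (t : R) df :
  is_derive t (1 : R) f df -> is_derive t (1 : R) (fun s => f s *m A) (df *m A).
Proof. by apply: (is_derive_linear (L := mulmxr A)); exact: mx_linear_continuous. Qed.

Lemma is_derive_mxP m n (f : R -> 'M[R]_(m, n)) (t : R) df :
  is_derive t (1 : R) f df <->
  forall i j, is_derive t (1 : R) (fun s => f s i j) (df i j).
Proof.
split=> [[Hf <-] i j|Hf].
- apply: DeriveDef; first by move/derivable_mxP: Hf; exact.
  by rewrite derive_mx// mxE.
- have Hd : derivable f t 1 by apply/derivable_mxP => i j; case: (Hf i j).
  apply: DeriveDef => //; apply/matrixP => i j; rewrite derive_mx// mxE.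
  by case: (Hf i j).
Qed.

Lemma mx_is_derive0_cst m n (f : R -> 'M[R]_(m, n)) s t :
  (forall u, is_derive u (1 : R) f 0) -> f s = f t.
Proof.
move=> Hf; apply/matrixP => i j.
apply: (@is_derive_0_is_cst _ (fun u => f u i j)) => u.
by have /is_derive_mxP /(_ i j) := Hf u; rewrite mxE.
Qed.

(** A subspace is the fixed space of the linear projection onto it, which commutes
    with derivation. *)
Lemma is_derive_vspace N (h : {vspace 'M[R]_N}) (f : R -> 'M[R]_N) (t : R) df :
  (forall s, f s \in h) -> is_derive t (1 : R) f df -> df \in h.
Proof.
move=> fh Df.
have Pf : projv h \o f = f by apply/funext => s /=; rewrite projv_id.
have [_ /= E] : is_derive t (1 : R) f (projv h df).
  rewrite -{1}Pf; apply: is_derive_linear => //; exact: mx_linear_continuous.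
by rewrite -[df](derive_val (is_derive := Df)) E memv_proj.
Qed.

End LinearAlgebraCalculus.

(** * The matrix exponential *)

Section MatrixExponential.
Context {R : realType}.

Lemma mx_cvg m n (f : nat -> 'M[R]_(m, n)) (M : 'M[R]_(m, n)) :
  (forall i j, (fun k => f k i j) @ \oo --> M i j) -> f @ \oo --> M.
Proof.
move=> fM A [P MP sPA].
have fP : \forall k \near \oo, forall i j, P i j (f k i j).
  by apply: filter_forall => i; apply: filter_forall => j; exact: fM (MP i j).
by apply: filterS fP => k; exact: sPA.
Qed.

Lemma mx_entry_norm_le m n (M : 'M[R]_(m, n)) i j : `|M i j| <= `|M|.
Proof. by rewrite [leRHS]/Num.norm/= mx_normrE; exact: (le_bigmax _ _ (i, j)). Qed.

Lemma mx_norm_le m n (M : 'M[R]_(m, n)) c :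
  0 <= c -> (forall i j, `|M i j| <= c) -> `|M| <= c.
Proof.
by move=> c0 Mc; rewrite [leLHS]/Num.norm/= mx_normrE bigmax_le.
Qed.

Lemma mulmx_norm_le m n p (A : 'M[R]_(m, n)) (C : 'M[R]_(n, p)) :
  `|A *m C| <= n%:R * `|A| * `|C|.
Proof.
apply: mx_norm_le => [|i j]; first by rewrite !mulr_ge0.
rewrite mxE (le_trans (ler_norm_sum _ _ _))//.
rewrite -mulrA mulr_natl -[X in _ *+ X]card_ord -sumr_const ler_sum// => k _.
by rewrite normrM ler_pM// mx_entry_norm_le.
Qed.

Context {N : nat}.
Implicit Types A C X : 'M[R]_N.

Lemma expmx_norm_le A k : `|A ^+ k| <= (N%:R * `|A|) ^+ k.
Proof.
elim: k => [|k IH].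
  rewrite !expr0; apply: mx_norm_le => // i j.
  by rewrite mxE; case: (i == j); rewrite ?normr1 ?normr0.
rewrite !exprS (le_trans (mulmx_norm_le _ _))// ler_wpM2l//.
Qed.

(** Entrywise domination by the series of the real exponential of N |A|: the factor
    N is the submultiplicativity constant of the maximum norm. *)
Lemma expm_cvg A : series (fun k => k`!%:R^-1 *: A ^+ k) @ \oo --> expm A.
Proof.
suff : cvgn (series (fun k => k`!%:R^-1 *: A ^+ k)) by [].
apply/cvg_ex.
pose u i j k := k`!%:R^-1 * (A ^+ k) i j.
exists (\matrix_(i, j) limn (series (u i j))).
apply: mx_cvg => i j; rewrite mxE.
have -> : (fun k => series (fun k0 => k0`!%:R^-1 *: A ^+ k0) k i j) = series (u i j).
  by apply/funext => k; rewrite /series/= summxE; apply: eq_bigr => l _; rewrite mxE.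
apply: normed_cvg.
apply: (@series_le_cvg _ _ (exp_coeff (N%:R * `|A|))) => [k|k|k|].
- exact: normr_ge0.
- by rewrite /exp_coeff divr_ge0// exprn_ge0// mulr_ge0.
- rewrite /u /exp_coeff/= normrM ger0_norm ?invr_ge0// mulrC ler_wpM2r ?invr_ge0//.
  exact: le_trans (mx_entry_norm_le _ _ _) (expmx_norm_le _ _).
- exact: is_cvg_series_exp_coeff.
Qed.

Lemma linear_expm_cvg (V : normedModType R) (L : {linear 'M[R]_N -> V}) A :
  series (fun k => k`!%:R^-1 *: L (A ^+ k)) @ \oo --> L (expm A).
Proof.
have -> : series (fun k => k`!%:R^-1 *: L (A ^+ k)) =
    L \o series (fun k => k`!%:R^-1 *: A ^+ k).
  apply/funext => n /=; rewrite /series/= linear_sum.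
  by apply: eq_bigr => k _; rewrite linearZ.
apply: continuous_cvg; [exact: mx_linear_continuous|exact: expm_cvg].
Qed.

(** Identities between images of exponentials under linear maps are checked on
    powers. *)
Lemma expm_eq (V : normedModType R) (L L' : {linear 'M[R]_N -> V}) A C :
  (forall k, L (A ^+ k) = L' (C ^+ k)) -> L (expm A) = L' (expm C).
Proof.
move=> LL'; have H := @linear_expm_cvg _ L A; have H' := @linear_expm_cvg _ L' C.
rewrite -(cvg_lim _ H)// -(cvg_lim _ H')//; congr (limn (series _)).
by apply/funext => k; rewrite LL'.
Qed.

Lemma expm_comm A : A *m expm A = expm A *m A.
Proof.
apply: (expm_eq (L := mulmx A) (L' := mulmxr A)) => k /=.
by rewrite -[LHS]exprS -[RHS]exprSr.
Qed.

Lemma expm_conj X A : X \in unitmx -> expm (X *m A *m invmx X) = X *m expm A *m invmx X.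
Proof.
move=> UX; apply: (expm_eq (L := idfun) (L' := mulmxr (invmx X) \o mulmx X)) => k /=.
elim: k => [|k IH]; first by rewrite !expr0 mulmx1 mulmxV.
by rewrite !exprS IH -!mulmxE !mulmxA mulmxKV.
Qed.

Lemma expm0 : expm 0 = 1%:M :> 'M[R]_N.
Proof.
apply: lim_near_cst => //; near=> n.
have -> : n = n.-1.+1 by rewrite prednK//; near: n; exists 1%N.
rewrite /series/= big_nat_recl// expr0 fact0 invr1 scale1r.
by rewrite big1 ?addr0// => k _; rewrite expr0n scaler0.
Unshelve. all: by end_near. Qed.

Lemma scaler_expmx (t : R) A k : (t *: A) ^+ k = t ^+ k *: A ^+ k.
Proof.
elim: k => [|k IH]; first by rewrite !expr0 scale1r.
by rewrite !exprS IH -!mulmxE -scalemxAl -scalemxAr scalerA.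
Qed.

(** Each entry of M exp(sA) is a power series in s, and differentiating the series
    termwise replaces M by M A. *)
Lemma is_derive_expm A (t : R) :
  is_derive t (1 : R) (fun s => expm (s *: A)) (A *m expm (t *: A)).
Proof.
apply/is_derive_mxP => i j.
pose c (M : 'M[R]_N) k := k`!%:R^-1 * (M *m A ^+ k) i j.
have cP M s : pseries (c M) s @ \oo --> (M *m expm (s *: A)) i j.
  have lin : linear (fun Y => (M *m Y) i j : R^o).
    by move=> a Y Z; rewrite mulmxDr -scalemxAr !mxE.
  pose LM := GRing.isLinear.Build _ _ _ _ _ lin.
  pose L : {linear 'M[R]_N -> R^o} := HB.pack (fun Y => (M *m Y) i j : R^o) LM.
  suff -> : pseries (c M) s = series (fun k => k`!%:R^-1 *: L ((s *: A) ^+ k)).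
    exact: linear_expm_cvg.
  rewrite /pseries; congr series; apply/funext => k.
  by rewrite /= scaler_expmx -scalemxAr mxE /c -mulrA [_ * s ^+ k]mulrC.
have dc M : pseries_diffs (c M) = c (M *m A).
  apply/funext => k; rewrite /pseries_diffs /c factS natrM invfM mulrA mulVKf//.
  by rewrite exprS -mulmxE mulmxA.
have -> : (fun s => expm (s *: A) i j) = fun s => limn (pseries (c 1%:M) s).
  by apply/funext => s; rewrite (cvg_lim _ (cP _ _))// mul1mx.
rewrite -(cvg_lim _ (cP A t))//.
have -> : c A = pseries_diffs (c 1%:M) by rewrite dc mul1mx.
apply: (@pseries_snd_diffs _ _ (`|t| + 1)); rewrite ?dc.
- by apply/cvg_ex; eexists; exact: cP.
- by apply/cvg_ex; eexists; exact: cP.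
- by apply/cvg_ex; eexists; exact: cP.
- by rewrite [ltRHS]ger0_norm ?addr_ge0// ltrDl.
Qed.

Lemma is_derive_expmN A (t : R) :
  is_derive t (1 : R) (fun s => expm (- (s *: A))) (- (A *m expm (- (t *: A)))).
Proof.
have := is_derive_expm (- A) t; rewrite mulNmx scalerN.
by under eq_fun do rewrite scalerN.
Qed.

Lemma expm_scale_comm A (t : R) : A *m expm (t *: A) = expm (t *: A) *m A.
Proof.
have [->|t0] := eqVneq t 0; first by rewrite scale0r expm0 mulmx1 mul1mx.
have := expm_comm (t *: A); rewrite -scalemxAl -scalemxAr.
by move/(scalerI t0).
Qed.

(** The product exp(tA) exp(-tA) has zero derivative; this avoids multiplying two
    series. *)
Lemma expmNK A : expm A *m expm (- A) = 1%:M.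
Proof.
pose f t := expm (t *: A) *m expm (- (t *: A)).
have f0 : f 0 = 1%:M by rewrite /f scale0r oppr0 expm0 mulmx1.
have -> : expm A *m expm (- A) = f 1 by rewrite /f scale1r.
rewrite -f0; apply: mx_is_derive0_cst => t.
have := is_derive_mulmx (is_derive_expm A t) (is_derive_expmN A t).
by rewrite mulmxN mulmxA -expm_scale_comm addNr.
Qed.

Lemma expmNV A : expm (- A) *m expm A = 1%:M.
Proof. by rewrite -{2}[A]opprK expmNK. Qed.

Lemma expm_unit A : expm A \in unitmx.
Proof. by case: (mulmx1_unit (expmNK A)). Qed.

Lemma invmx_expm A : invmx (expm A) = expm (- A).
Proof. by rewrite -[LHS]mulmx1 -(expmNK A) mulKmx// expm_unit. Qed.

Lemma is_derive_Ad A X (t : R) :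
  is_derive t (1 : R) (fun s => expm (s *: A) *m X *m expm (- (s *: A)))
    (mxbr A (expm (t *: A) *m X *m expm (- (t *: A)))).
Proof.
have := is_derive_mulmx (is_derive_mulmxr X (is_derive_expm A t)) (is_derive_expmN A t).
have cN : A *m expm (- (t *: A)) = expm (- (t *: A)) *m A.
  by rewrite -scaleNr expm_scale_comm.
by rewrite cN mulmxN addrC /mxbr !mulmxA.
Qed.

End MatrixExponential.

(** * The differential of the exponential at zero *)

Section ExponentialAtZero.
Context {R : realType} {N : nat}.
Implicit Types A : 'M[R]_N.

(** The tail of the series is bounded by r^2 exp(r) because 1/(k+2)! <= 1/k!. *)
Lemma expm_remainder A :
  `|expm A - 1%:M - A| <= (N%:R * `|A|) ^+ 2 * expR (N%:R * `|A|).
Proof.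
set r := N%:R * `|A|; have r0 : 0 <= r by rewrite mulr_ge0.
pose s k := k`!%:R^-1 *: A ^+ k.
have cvs : (fun n => series s n.+2 - 1%:M - A) @ \oo --> expm A - 1%:M - A.
  apply: cvgB; last exact: cvg_cst.
  apply: cvgB; last exact: cvg_cst.
  have := @expm_cvg _ _ A; rewrite -(cvg_shiftn 2%N).
  by under eq_fun do rewrite addn2.
have le n : `|series s n.+2 - 1%:M - A| <= r ^+ 2 * expR r.
  rewrite /series/= !big_nat_recl//= /s expr0 expr1 !fact0 invr1 !scale1r.
  have E (u v w : 'M[R]_N) : u + (v + w) - u - v = w.
    by rewrite [u + _]addrC addrK addrC addKr.
  rewrite E.
  rewrite (le_trans (ler_norm_sum _ _ _))//.
  apply: (@le_trans _ _ (r ^+ 2 * series (exp_coeff r) n)).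
    rewrite /series/= mulr_sumr ler_sum// => k _.
    rewrite normrZ ger0_norm ?invr_ge0// /exp_coeff/= mulrA -exprD add2n mulrC.
    rewrite ler_pM ?invr_ge0//; first exact: expmx_norm_le.
    by rewrite lef_pV2 ?posrE ?ltr0n ?fact_gt0// ler_nat leq_fact// -addn2 leq_addr.
  rewrite ler_wpM2l ?exprn_ge0//.
  apply: nondecreasing_cvgn_le; last exact: is_cvg_series_exp_coeff.
  apply/nondecreasing_seqP => k; rewrite /series/= big_nat_recr//= lerDl.
  by rewrite /exp_coeff divr_ge0// exprn_ge0.
rewrite -(cvg_lim _ (cvg_norm cvs))//; apply: limr_le.
  by apply/cvg_ex; eexists; exact: cvg_norm cvs.
by near=> n; exact: le.
Unshelve. all: by end_near. Qed.

Lemma is_diff_expm0 : is_diff (0 : 'M[R]_N) expm id.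
Proof.
(* The radius d1 makes N |A| <= 1, and d2 e makes the remainder at most e |A|. *)
pose d1 : R := N.+1%:R^-1.
pose d2 (e : R) := (N%:R ^+ 2 * expR 1 + 1)^-1 * e.
have c0 : 0 < N%:R ^+ 2 * expR 1 + 1 :> R.
  by rewrite ltr_wpDl// mulr_ge0 ?expR_ge0.
have near1 : \forall A \near (0 : 'M[R]_N), `|A| <= d1.
  by apply: nbhs0_le; rewrite invr_gt0.
have near2 e : 0 < e -> \forall A \near (0 : 'M[R]_N), `|A| <= d2 e.
  by move=> e0; apply: nbhs0_le; rewrite mulr_gt0// invr_gt0.
have ex : expm \o shift (0 : 'M[R]_N) = cst (expm 0) + id +o_ (0 : 'M[R]_N) id.
  apply/eqaddoP => _/posnumP[e]; near=> A.
  rewrite /= [X in `|X|](_ : _ = expm A - 1%:M - A); last first.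
    by rewrite !fctE/= addr0 expm0 opprD addrA.
  apply: le_trans (expm_remainder A) _.
  have A1 : `|A| <= d1 by near: A; exact: near1.
  have Ae : `|A| <= d2 e%:num by near: A; exact: near2.
  have r1 : N%:R * `|A| <= 1.
    by rewrite (le_trans (ler_wpM2l _ A1))// ler_pdivrMr// mul1r ler_nat.
  apply: (@le_trans _ _ ((N%:R ^+ 2 * expR 1 * `|A|) * `|A|)).
    rewrite exprMn mulrAC [`|A| ^+ 2]expr2 mulrA !ler_wpM2r// ler_wpM2l//.
    by rewrite ler_expR.
  rewrite ler_wpM2r//.
  apply: (@le_trans _ _ ((N%:R ^+ 2 * expR 1 + 1) * d2 e%:num)).
    by rewrite ler_pM// ?mulr_ge0 ?expR_ge0// lerDl.
  by rewrite mulVKf ?gt_eqF.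
have D : 'd expm (0 : 'M[R]_N) = id :> ('M[R]_N -> 'M[R]_N).
  by apply: (@diff_unique _ _ _ _ idfun) ex => ?.
apply: DiffDef => //; apply/diff_locallyP; by rewrite D; split => // ?.
Unshelve. all: by end_near. Qed.

End ExponentialAtZero.

(** * Linear equations with constant coefficients *)

Section OperatorExponential.
Context {R : realType}.

(** The function e(u) exp(-uQ) has zero derivative. *)
Lemma right_ode_unique m n (Q : 'M[R]_n) (e : R -> 'M[R]_(m, n)) t :
  (forall u, is_derive u (1 : R) e (e u *m Q)) -> e t = e 0 *m expm (t *: Q).
Proof.
move=> De.
pose f u := e u *m expm (- (u *: Q)).
have f0 u : is_derive u (1 : R) f 0.
  have := is_derive_mulmx (De u) (is_derive_expmN Q u).
  by rewrite mulmxN mulmxA addNr.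
have : f t = e 0.
  by rewrite (@mx_is_derive0_cst _ _ _ f t 0)// /f scale0r oppr0 expm0 mulmx1.
by move=> <-; rewrite /f -mulmxA expmNV mulmx1.
Qed.

Context {N : nat}.
Variable P : {linear 'M[R]_N -> 'M[R]_N}.
Implicit Types (v : 'M[R]_N) (t : R).

Lemma vec_mx_lin (u : 'rV[R]_(N * N)) : vec_mx (u *m lin_mx P) = P (vec_mx u).
Proof. by rewrite -{1}[u]vec_mxK mul_vec_lin mxvecK. Qed.

(** An operator on matrices is itself a matrix of size N * N acting on flattened
    row vectors, so the theory of [expv] reduces to that of [expm]. *)
Lemma iter_lin_mx t v k :
  iter k (fun C => t *: P C) v = vec_mx (mxvec v *m (t *: lin_mx P) ^+ k).
Proof.
elim: k => [|k IH] /=; first by rewrite expr0 mulmx1 mxvecK.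
by rewrite IH exprSr -mulmxE mulmxA -scalemxAr linearZ/= vec_mx_lin.
Qed.

Lemma expv_expm t v :
  expv (fun C => t *: P C) v = vec_mx (mxvec v *m expm (t *: lin_mx P)).
Proof.
have H := @linear_expm_cvg _ _ _ (vec_mx \o mulmx (mxvec v)) (t *: lin_mx P).
rewrite -[RHS](cvg_lim _ H)//; congr (limn (series _)).
by apply/funext => k; rewrite iter_lin_mx.
Qed.

Lemma expv0 v : expv (fun C => 0 *: P C) v = v.
Proof. by rewrite expv_expm scale0r expm0 mulmx1 mxvecK. Qed.

Lemma is_derive_expv v t :
  is_derive t (1 : R) (fun s => expv (fun C => s *: P C) v)
    (P (expv (fun C => t *: P C) v)).
Proof.
under eq_fun do rewrite expv_expm.
rewrite expv_expm -vec_mx_lin -mulmxA -expm_scale_comm.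
have := is_derive_mulmxl (mxvec v) (is_derive_expm (lin_mx P) t).
by apply: is_derive_linear; exact: mx_linear_continuous.
Qed.

Lemma expv_unique (E : R -> 'M[R]_N) t :
  (forall u, is_derive u (1 : R) E (P (E u))) ->
  E t = expv (fun C => t *: P C) (E 0).
Proof.
move=> DE.
have De u : is_derive u (1 : R) (mxvec \o E) (mxvec (E u) *m lin_mx P).
  rewrite mul_vec_lin; apply: is_derive_linear => //.
  exact: mx_linear_continuous.
by rewrite expv_expm -(right_ode_unique t De)/= mxvecK.
Qed.

Lemma expv_mem (h : {vspace 'M[R]_N}) v t :
  (forall C, C \in h -> P C \in h) -> v \in h -> expv (fun C => t *: P C) v \in h.
Proof.
move=> Ph vh.
have itP k : iter k (fun C => t *: P C) v \in h.
  by elim: k => //= k IH; rewrite memvZ// Ph.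
rewrite expv_expm; set w := vec_mx _.
suff <- : projv h w = w by exact: memv_proj.
apply: (expm_eq (L := projv h \o (vec_mx \o mulmx (mxvec v)))
                (L' := vec_mx \o mulmx (mxvec v))) => k /=.
by rewrite -iter_lin_mx projv_id.
Qed.

End OperatorExponential.

(** * Exponential charts and C^k functions on a Lie subgroup *)

Section LieGroup.
Context {R : realType} {N : nat} {G : set 'M[R]_N} {g : {vspace 'M[R]_N}}.
Hypothesis HG : connected_lie_subgroup G g.
Implicit Types A C X Y H : 'M[R]_N.

Lemma lie_expm A : A \in g -> G (expm A).
Proof. by move/(lie_algE HG)/(_ 1); rewrite scale1r. Qed.

Lemma lie_chart X A : G X -> A \in g -> G (X *m expm A).
Proof. by move=> GX Ag; apply: (lie_mul HG) => //; exact: lie_expm. Qed.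

(** The one-parameter group of X A X^-1 is the conjugate of the one of A, and the
    Lie algebra is characterized by its one-parameter groups. *)
Lemma lie_Ad_mem X A : G X -> A \in g -> X *m A *m invmx X \in g.
Proof.
move=> GX Ag; apply/(lie_algE HG) => t.
rewrite scalemxAl scalemxAr expm_conj ?(lie_unit HG)//.
apply: (lie_mul HG); last exact: (lie_inv HG).
by apply: lie_chart => //; rewrite memvZ.
Qed.

Lemma tangentP X xi : G X -> tangent g X xi <-> invmx X *m xi \in g.
Proof.
move=> GX; split=> [[A Ag <-]|Hxi]; first by rewrite mulKmx ?(lie_unit HG).
by exists (invmx X *m xi) => //; rewrite mulKVmx ?(lie_unit HG).
Qed.

Lemma tangent_mul X A : A \in g -> tangent g X (X *m A).
Proof. by move=> Ag; exists A. Qed.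

Lemma is_diff_chart X :
  is_diff 0 (fun A => X *m expm (projv g A)) (fun A => X *m projv g A).
Proof.
have D0 : is_diff (projv g 0) expm id by rewrite linear0; exact: is_diff_expm0.
have Dp : is_diff 0 (projv g) (projv g) by exact: is_diff_mx_linear.
have D1 := is_diff_comp Dp D0.
have DX : is_diff ((expm \o projv g) 0) (mulmx X) (mulmx X).
  exact: is_diff_mx_linear.
exact: (is_diff_comp D1 DX).
Qed.

Section Values.
Context {V : normedModType R}.
Implicit Types f : 'M[R]_N -> V.

Lemma is_derive_chart f X A df : A \in g -> is_diff 0 (in_chart g f X) df ->
  is_derive (0 : R) (1 : R) (fun t => f (X *m expm (t *: A))) (df A).
Proof.
move=> Ag Df; apply/is_derive_is_diff.
have D1 : is_diff (0 : R) ( *:%R^~ A) ( *:%R^~ A) by exact: is_diff_scalel.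
have D0 : is_diff (0 *: A) (in_chart g f X) df by rewrite scale0r.
have := @is_diff_comp _ _ _ _ _ _ _ _ _ D1 D0.
have -> : in_chart g f X \o *:%R^~ A = fun t => f (X *m expm (t *: A)).
  by apply/funext => t /=; rewrite /in_chart projv_id// memvZ.
move=> D; apply: is_diff_eq D _; apply/funext => t /=.
by case: Df => _ <-; rewrite linearZ.
Qed.

Lemma dirD_eq f X A df : G X ->
  is_derive (0 : R) (1 : R) (fun t => f (X *m expm (t *: A))) df ->
  dirD f X (X *m A) = df.
Proof.
by move=> GX Df; rewrite /dirD mulKmx ?(lie_unit HG)//; exact: is_derive_derive1.
Qed.

Lemma dirD_chart f X A df : G X -> A \in g -> is_diff 0 (in_chart g f X) df ->
  dirD f X (X *m A) = df A.
Proof.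
by move=> GX Ag Df; apply: dirD_eq => //; exact: is_derive_chart.
Qed.

Lemma in_chart_ext f f' X : G X -> (forall Y, G Y -> f Y = f' Y) ->
  in_chart g f X = in_chart g f' X.
Proof.
by move=> GX ff'; apply/funext => A; rewrite /in_chart ff'//; apply: lie_chart => //; exact: memv_proj.
Qed.

Lemma dirD_ext f f' X A : G X -> A \in g -> (forall Y, G Y -> f Y = f' Y) ->
  dirD f X (X *m A) = dirD f' X (X *m A).
Proof.
move=> GX Ag ff'; rewrite /dirD mulKmx ?(lie_unit HG)//; congr derive1.
by apply/funext => t; rewrite ff'//; apply: lie_chart => //; rewrite memvZ.
Qed.

Lemma Ck_ext k f f' : (forall Y, G Y -> f Y = f' Y) -> Ck_on G g k f -> Ck_on G g k f'.
Proof.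
elim: k f f' => [|k IH] f f' ff' /=.
  by move=> Hf X GX; rewrite -(in_chart_ext GX ff'); exact: Hf.
move=> [Hf Df]; split=> [X GX|A Ag].
  by rewrite -(in_chart_ext GX ff'); exact: Hf.
by apply: IH (Df A Ag) => Y GY; exact: dirD_ext.
Qed.

Lemma Ck_S k f : Ck_on G g k.+1 f -> Ck_on G g k f.
Proof.
elim: k f => [|k IH] f [Hf Df].
  by move=> X GX; apply: differentiable_continuous; exact: Hf.
by split=> // A Ag; apply: IH; exact: Df.
Qed.

Lemma Ck_chart_diff k f X : G X -> Ck_on G g k.+1 f ->
  is_diff 0 (in_chart g f X) ('d (in_chart g f X) 0).
Proof. by move=> GX [Hf _]; apply: differentiableP; exact: Hf. Qed.

Lemma Ck_is_derive k f X A : G X -> A \in g -> Ck_on G g k.+1 f ->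
  is_derive (0 : R) (1 : R) (fun t => f (X *m expm (t *: A))) (dirD f X (X *m A)).
Proof.
move=> GX Ag Hf; rewrite (dirD_chart GX Ag (Ck_chart_diff GX Hf)).
by apply: is_derive_chart => //; exact: Ck_chart_diff Hf.
Qed.

(** The form in which membership in C^(k+1) is established: the candidate
    differential needs to be identified on G only. *)
Lemma Ck_step k f (df : 'M[R]_N -> 'M[R]_N -> V) :
  (forall X, G X -> is_diff 0 (in_chart g f X) (df X)) ->
  (forall A, A \in g -> Ck_on G g k (df^~ A)) -> Ck_on G g k.+1 f.
Proof.
move=> Df Hdf; split=> [X GX|A Ag]; first by case: (Df X GX).
by apply: Ck_ext (Hdf A Ag) => X GX; rewrite (dirD_chart GX Ag (Df X GX)).
Qed.

Lemma Ck_diff k f A : A \in g -> Ck_on G g k.+1 f ->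
  Ck_on G g k (fun X => 'd (in_chart g f X) 0 A).
Proof.
move=> Ag Hf; have [_ Df] := Hf; apply: Ck_ext (Df A Ag) => X GX.
exact: dirD_chart (Ck_chart_diff GX Hf).
Qed.

Lemma Ck_cst k (v : V) : Ck_on G g k (cst v).
Proof.
elim: k v => [|k IH] v; first by move=> X GX; exact: cst_continuous.
apply: (@Ck_step _ _ (fun _ => 0)) => [X GX|A Ag]; last exact: IH.
exact: is_diff_cst.
Qed.

Lemma Ck_add k f f' : Ck_on G g k f -> Ck_on G g k f' ->
  Ck_on G g k (fun X => f X + f' X).
Proof.
elim: k f f' => [|k IH] f f' Hf Hf'.
  by move=> X GX; apply: continuousD; [exact: Hf|exact: Hf'].
apply: (@Ck_step _ _ (fun X A => 'd (in_chart g f X) 0 A + 'd (in_chart g f' X) 0 A)).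
  move=> X GX.
  have D1 := Ck_chart_diff GX Hf; have D2 := Ck_chart_diff GX Hf'.
  exact: is_diffD.
by move=> A Ag; apply: IH; exact: Ck_diff.
Qed.

End Values.

Lemma in_chart0 (V : normedModType R) (f : 'M[R]_N -> V) X : in_chart g f X 0 = f X.
Proof. by rewrite /in_chart linear0 expm0 mulmx1. Qed.

Lemma Ck_lin k (U V : normedModType R) (L : {linear U -> V}) (f : 'M[R]_N -> U) :
  continuous L -> Ck_on G g k f -> Ck_on G g k (fun X => L (f X)).
Proof.
move=> cL; elim: k f => [|k IH] f Hf.
  by move=> X GX; apply: (@continuous_comp _ _ _ (in_chart g f X) L); [exact: Hf|exact: cL].
apply: (@Ck_step _ _ _ (fun X A => L ('d (in_chart g f X) 0 A))).
  move=> X GX.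
  exact: (is_diff_comp (Ck_chart_diff GX Hf) (is_diff_linear _ cL)).
by move=> A Ag; apply: IH; exact: Ck_diff.
Qed.

Lemma Ck_bilin k (U V W : normedModType R) (b : {bilinear U -> V -> W})
    (f : 'M[R]_N -> U) (h : 'M[R]_N -> V) :
  continuous (fun p => b p.1 p.2) -> Ck_on G g k f -> Ck_on G g k h ->
  Ck_on G g k (fun X => b (f X) (h X)).
Proof.
move=> cb; elim: k f h => [|k IH] f h Hf Hh.
  move=> X GX; have cf := Hf X GX; have ch := Hh X GX.
  have cfh : {for 0, continuous (fun A => (in_chart g f X A, in_chart g h X A))}.
    exact: cvg_pair cf ch.
  exact: (continuous_comp cfh (cb _)).
apply: (@Ck_step _ _ _ (fun X A => b (f X) ('d (in_chart g h X) 0 A) +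
                                   b ('d (in_chart g f X) 0 A) (h X))).
  move=> X GX.
  have D : is_diff 0 (in_chart g (fun Y => b (f Y) (h Y)) X) _ :=
    is_diff_bilin cb (Ck_chart_diff GX Hf) (Ck_chart_diff GX Hh).
  by apply: is_diff_eq D _; apply/funext => A; rewrite !in_chart0.
by move=> A Ag; apply: Ck_add; apply: IH; (exact: Ck_diff || exact: Ck_S).
Qed.

(** A function whose derivative along the left-invariant field of A is a linear
    function of itself is smooth: differentiation only changes the linear map L.
    The inclusion of G into the matrices and the inversion are of this kind. *)
Lemma Ck_linear_flow k (V : normedModType R) (L : {linear 'M[R]_N -> V})
    (f : 'M[R]_N -> 'M[R]_N) (D : 'M[R]_N -> {linear 'M[R]_N -> 'M[R]_N}) :
  (forall X, G X -> is_diff 0 (in_chart g f X) (fun H => D (projv g H) (f X))) ->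
  Ck_on G g k (fun X => L (f X)).
Proof.
move=> Df; elim: k L => [|k IH] L.
  move=> X GX; apply: (@continuous_comp _ _ _ (in_chart g f X) L).
    by apply: differentiable_continuous; case: (Df X GX).
  exact: mx_linear_continuous.
apply: (@Ck_step _ _ _ (fun X A => L (D (projv g A) (f X)))).
  move=> X GX.
  exact: (is_diff_comp (Df X GX) (is_diff_mx_linear L _)).
by move=> A Ag; exact: (IH (L \o D (projv g A))).
Qed.

Lemma Ck_id k : Ck_on G g k (fun X : 'M[R]_N => X).
Proof.
apply: (@Ck_linear_flow _ _ idfun (fun X => X) (fun A => mulmxr A)) => X GX.
exact: is_diff_chart.
Qed.

Lemma Ck_inv k : Ck_on G g k (fun X : 'M[R]_N => invmx X).
Proof.
apply: (@Ck_linear_flow _ _ idfun (@invmx _ _) (fun A => mulmx (- A))) => X GX.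
have -> : in_chart g (@invmx _ _) X = fun A => expm (- projv g A) *m invmx X.
  apply/funext => A; rewrite /in_chart.
  have UX := lie_unit HG GX; have UE := expm_unit (projv g A).
  have UXE : X *m expm (projv g A) \in unitmx by rewrite unitmx_mul UX.
  rewrite -[RHS](mulmxK UXE) [_ *m (X *m _)]mulmxA mulmxKV//.
  by rewrite expmNV mul1mx.
have D0 : is_diff ((-%R \o projv g) 0) expm id.
  by rewrite /= linear0 oppr0; exact: is_diff_expm0.
have Dp : is_diff 0 (-%R \o projv g) (-%R \o projv g) by exact: is_diff_mx_linear.
have D1 := is_diff_comp Dp D0.
have DX : is_diff ((expm \o (-%R \o projv g)) 0) (mulmxr (invmx X)) (mulmxr (invmx X)).
  exact: is_diff_mx_linear.
exact: (is_diff_comp D1 DX).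
Qed.

End LieGroup.

(** * Forms and operators defined on a subspace *)

Section BilinearForms.
Context {R : realType} {N : nat}.
Implicit Types (h : {vspace 'M[R]_N}) (f : 'M[R]_N -> 'M[R]_N -> R).

Lemma mxbr_is_bilinear : bilinear_for
  (GRing.Scale.Law.clone _ _ *:%R _) (GRing.Scale.Law.clone _ _ *:%R _)
  (@mxbr R N).
Proof.
split=> [u'|u] k x y; rewrite /mxbr /= mulmxDl mulmxDr -scalemxAl -scalemxAr;
  by rewrite opprD addrACA -scalerBr.
Qed.

HB.instance Definition _ := bilinear_isBilinear.Build R 'M[R]_N 'M[R]_N 'M[R]_N
  _ _ (@mxbr R N) mxbr_is_bilinear.

Lemma mxbrC (x y : 'M[R]_N) : mxbr x y = - mxbr y x.
Proof. by rewrite /mxbr opprB. Qed.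

(** An operator which is only known to be linear on h agrees there with a globally
    linear one, so that the generic theory of linear maps applies. *)
Lemma linear_extension h (L : 'M[R]_N -> 'M[R]_N) :
  (forall k A C, A \in h -> C \in h -> L (k *: A + C) = k *: L A + L C) ->
  exists L' : {linear 'M[R]_N -> 'M[R]_N}, forall A, A \in h -> L' A = L A.
Proof.
move=> Llin.
have lin : linear (L \o projv h).
  by move=> k A C; rewrite /= linearP Llin ?memv_proj.
pose LM := GRing.isLinear.Build _ _ _ _ _ lin.
pose L' : {linear 'M[R]_N -> 'M[R]_N} := HB.pack (L \o projv h) LM.
by exists L' => A Ah; rewrite /= projv_id.
Qed.

Lemma form_extension h f : symmetric_bilinear h f ->
  exists b : {bilinear 'M[R]_N -> 'M[R]_N -> R^o},
    forall A C, A \in h -> C \in h -> b A C = f A C.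
Proof.
move=> [flin fsym].
pose b A C : R^o := f (projv h A) (projv h C).
have bb : bilinear_for
    (GRing.Scale.Law.clone _ _ *:%R _) (GRing.Scale.Law.clone _ _ *:%R _) b.
  split=> [u'|u] k x y; rewrite /b/=.
    by rewrite linearP flin ?memv_proj.
  by rewrite linearP ![f (projv h u) _]fsym ?rpredD ?memvZ ?memv_proj// flin ?memv_proj.
pose bM := bilinear_isBilinear.Build R 'M[R]_N 'M[R]_N R^o _ _ b bb.
pose b' : {bilinear 'M[R]_N -> 'M[R]_N -> R^o} := HB.pack b bM.
by exists b' => A C Ah Ch; rewrite /= /b !projv_id.
Qed.

End BilinearForms.

(** * Orthogonal projection for an indefinite form *)

Section OrthogonalProjection.
Context {R : realType} {N : nat} {a g : {vspace 'M[R]_N}}.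
Variable ip : 'M[R]_N -> 'M[R]_N -> R.
Hypothesis ip_bilin : symmetric_bilinear g ip.
Hypothesis ag : (a <= g)%VS.
Hypothesis ip_nondeg_a : nondegenerate_on a ip.
Let aing := subvP ag.

(** Pairing with a basis of a maps a injectively into a space of the same dimension,
    by nondegeneracy on a, hence onto it. *)
Lemma orth_proj_ex A : A \in g ->
  exists P, P \in a /\ forall C, C \in a -> ip (A - P) C = 0.
Proof.
move=> Ag; have [b bE] := form_extension ip_bilin.
pose X := vbasis a.
have lin : linear (fun D => \row_j (b D X`_j) : 'rV[R]_(\dim a)).
  by move=> k D E; apply/rowP => j; rewrite !mxE linearPl.
pose LM := GRing.isLinear.Build _ _ _ _ _ lin.
pose L : {linear 'M[R]_N -> 'rV[R]_(\dim a)} := HB.pack (fun D => \row_j (b D X`_j)) LM.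
have L0 D : D \in g -> L D = 0 -> forall C, C \in a -> ip D C = 0.
  move=> Dg /rowP LD C Ca.
  rewrite -bE ?(aing Ca)// (coord_vbasis Ca) linear_sumr big1// => j _.
  rewrite linearZr_LR/=.
  by have := LD j; rewrite !mxE => ->; rewrite scaler0.
have Lker : (a :&: lker (linfun L) = 0)%VS.
  apply/eqP; rewrite -subv0; apply/subvP => D; rewrite memv_cap memv_ker lfunE memv0.
  move=> /andP[Da /eqP LD]; apply/eqP; apply: ip_nondeg_a => //.
  by apply: L0 => //; exact: aing.
have Lsurj : (linfun L @: a = fullv)%VS.
  apply/eqP; rewrite eqEdim subvf limg_dim_eq// dimvf /dim/=.
  by rewrite mul1n.
have : linfun L A \in (linfun L @: a)%VS by rewrite Lsurj memvf.
move=> /memv_imgP[P Pa]; rewrite !lfunE => LAP.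
exists P; split => //; apply: L0; first by rewrite rpredB// aing.
by rewrite linearB/= [X in X - _]LAP subrr.
Qed.

Lemma orth_projP A : A \in g -> orth_proj a ip A \in a /\
  forall C, C \in a -> ip (A - orth_proj a ip A) C = 0.
Proof.
move=> /orth_proj_ex[P HP].
exact: (@xgetI _ 0 [set P | P \in a /\ forall C, C \in a -> ip (A - P) C = 0] P).
Qed.

Lemma orth_proj_mem A : A \in g -> orth_proj a ip A \in a.
Proof. by case/orth_projP. Qed.

Lemma orth_proj_eq A P : A \in g -> P \in a ->
  (forall C, C \in a -> ip (A - P) C = 0) -> orth_proj a ip A = P.
Proof.
move=> Ag Pa HP; have [Qa HQ] := orth_projP Ag.
have [b bE] := form_extension ip_bilin.
apply/eqP; rewrite -subr_eq0; apply/eqP; apply: ip_nondeg_a.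
  by rewrite rpredB.
move=> C Ca; have Cg := aing Ca.
have -> : orth_proj a ip A - P = (A - P) - (A - orth_proj a ip A).
  by rewrite opprB [RHS]addrC addrA subrK.
have Pg := aing Pa; have Qg := aing Qa.
rewrite -bE ?rpredB// linearBl/= !bE ?rpredB//.
by rewrite HP// HQ// subrr.
Qed.

Lemma orth_proj_id A : A \in a -> orth_proj a ip A = A.
Proof.
move=> Aa; apply: orth_proj_eq => // [|C Ca]; first exact: aing.
have [b bE] := form_extension ip_bilin.
by rewrite subrr -bE ?mem0v ?aing// linear0l.
Qed.

Lemma orth_proj_linear k A C : A \in g -> C \in g ->
  orth_proj a ip (k *: A + C) = k *: orth_proj a ip A + orth_proj a ip C.
Proof.
move=> Ag Cg; have [PA HA] := orth_projP Ag; have [PC HC] := orth_projP Cg.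
apply: orth_proj_eq => [||D Da]; [by rewrite rpredD ?memvZ|by rewrite rpredD ?memvZ|].
rewrite opprD addrACA -scalerBr.
have PgA := aing PA; have PgC := aing PC; have Dg := aing Da.
by rewrite ip_bilin.1 ?rpredB// HA// HC// mulr0 addr0.
Qed.

Lemma ip_orth_projl A C : A \in g -> C \in a -> ip (orth_proj a ip A) C = ip A C.
Proof.
move=> Ag Ca; have [PA HA] := orth_projP Ag; have Cg := aing Ca.
have [b bE] := form_extension ip_bilin.
have Pg := aing PA; apply/esym/eqP; rewrite -subr_eq0 -!bE//.
by rewrite -[_ - _]linearBl/= bE ?rpredB// HA.
Qed.

End OrthogonalProjection.

(** * The operator phi *)

Section Phi.
Context {R : realType} {N : nat}.
Context {G : set 'M[R]_N} {g : {vspace 'M[R]_N}}.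
Hypothesis HG : connected_lie_subgroup G g.
Variable ip : 'M[R]_N -> 'M[R]_N -> R.
Hypothesis ip_bilin : symmetric_bilinear g ip.
Hypothesis ip_inv : bi_invariant G g ip.
Context {A : set 'M[R]_N} {a : {vspace 'M[R]_N}}.
Hypothesis HA : connected_lie_subgroup A a.
Hypothesis sAG : A `<=` G.
Hypothesis ip_nondeg_a : nondegenerate_on a ip.
Variable B : 'M[R]_N -> 'M[R]_N.
Hypothesis B_itw : intertwining A a ip B.
Variable beta0 : R.
Hypothesis beta0_neq0 : beta0 != 0.

Notation P := (orth_proj a ip).
Notation phi := (IBP a ip beta0 B).

Lemma sub_lie_alg : (a <= g)%VS.
Proof.
apply/subvP => x /(lie_algE HA) Ax.
by apply/(lie_algE HG) => t; exact: sAG.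
Qed.
Let ag := sub_lie_alg.
Let aing := subvP ag.

Lemma phi_mem x : x \in g -> phi x \in a.
Proof.
move=> xg; have Px := orth_proj_mem ip_bilin ag ip_nondeg_a xg.
by rewrite rpredD// memvZ// (itw_stable B_itw).
Qed.

Lemma phi_linear k x y : x \in g -> y \in g -> phi (k *: x + y) = k *: phi x + phi y.
Proof.
move=> xg yg; rewrite /IBP (orth_proj_linear ip_bilin ag)// (itw_linear B_itw); last 2 first.
- exact: (orth_proj_mem ip_bilin ag).
- exact: (orth_proj_mem ip_bilin ag).
by rewrite !scalerDr addrACA !scalerA mulrC.
Qed.

Lemma ip_Ad h x y : G h -> x \in g -> y \in g ->
  ip (h *m x *m invmx h) y = ip x (invmx h *m y *m h).
Proof.
move=> Gh xg yg; have Uh := lie_unit HG Gh.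
have {1}-> : y = h *m (invmx h *m y *m h) *m invmx h.
  by rewrite !mulmxA mulmxV// mul1mx mulmxK.
rewrite ip_inv// -{2}[h]invmxK.
by apply: (lie_Ad_mem HG) => //; exact: (lie_inv HG).
Qed.

(** Ad_h preserves the form and maps a onto itself, so it preserves the
    characterization of the projection. *)
Lemma orth_proj_Ad h x : A h -> x \in g ->
  P (h *m x *m invmx h) = h *m P x *m invmx h.
Proof.
move=> Ah xg; have Gh := sAG Ah; have [Px HP] := orth_projP ip_bilin ag ip_nondeg_a xg.
apply: (orth_proj_eq ip_bilin ag) => // [||C Ca].
- exact: (lie_Ad_mem HG).
- exact: (lie_Ad_mem HA).
have Pg := aing Px; have Cg := aing Ca.
rewrite -mulmxBl -mulmxBr ip_Ad ?rpredB//; apply: HP.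
rewrite -{2}[h]invmxK; apply: (lie_Ad_mem HA) => //; exact: (lie_inv HA).
Qed.

(** Pair B (Ad_h x) - Ad_h (B x) with an arbitrary y in a, and move Ad_h to y by the
    invariance of ip and of x, y |-> ip x (B y). *)
Lemma itw_Ad h x : A h -> x \in a -> B (h *m x *m invmx h) = h *m B x *m invmx h.
Proof.
move=> Ah xa; have Gh := sAG Ah; have Uh := lie_unit HG Gh.
have Ad_a y : y \in a -> h *m y *m invmx h \in a by move=> ya; exact: (lie_Ad_mem HA).
have Ad'_a y : y \in a -> invmx h *m y *m h \in a.
  by move=> ya; rewrite -{2}[h]invmxK; apply: (lie_Ad_mem HA) => //; exact: (lie_inv HA).
have Ba := itw_stable B_itw.
apply/eqP; rewrite -subr_eq0; apply/eqP; apply: ip_nondeg_a.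
  by rewrite rpredB ?Ba ?Ad_a ?Ba.
move=> y ya.
have [b bE] := form_extension ip_bilin.
have HB := itw_bi_invariant B_itw Ah (Ad'_a _ ya) xa.
have yg := aing ya; have Bxg := aing (Ba _ xa).
have Adxg := aing (Ba _ (Ad_a _ xa)); have AdBxg := aing (Ad_a _ (Ba _ xa)).
have Adyg := aing (Ad'_a _ ya).
rewrite -bE ?rpredB// linearBl/= !bE// ip_Ad// ip_bilin.2// [ip (B x) _]ip_bilin.2//.
apply/eqP; rewrite subr_eq0; apply/eqP; rewrite -HB; congr ip.
by rewrite !mulmxA mulmxV// mul1mx mulmxK.
Qed.

Lemma phi_Ad h x : A h -> x \in g -> phi (h *m x *m invmx h) = h *m phi x *m invmx h.
Proof.
move=> Ah xg; rewrite /IBP orth_proj_Ad// itw_Ad//; last exact: (orth_proj_mem ip_bilin ag).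
by rewrite mulmxDr mulmxDl -scalemxAr -scalemxAl.
Qed.

Lemma phi_selfadjoint x y : x \in g -> y \in g -> ip (phi x) y = ip x (phi y).
Proof.
move=> xg yg.
have [b bE] := form_extension ip_bilin.
have Ba := itw_stable B_itw.
have Pa z : z \in g -> P z \in a by move=> zg; exact: (orth_proj_mem ip_bilin ag).
have Pg z : z \in g -> P z \in g by move=> zg; apply/aing/Pa.
have BPg z : z \in g -> B (P z) \in g by move=> zg; apply/aing/Ba/Pa.
have H u v : u \in g -> v \in g ->
    ip (phi u) v = ip (P u) (P v) + beta0^-1 * ip (B (P u)) (P v).
  move=> ug vg.
  have PE w : w \in a -> ip w v = ip w (P v).
    move=> wa; have wg := aing wa; rewrite ip_bilin.2//.
    by rewrite -(ip_orth_projl ip_bilin ag)// ip_bilin.2 ?Pg.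
  rewrite PE ?phi_mem// /IBP -bE ?rpredD ?memvZ ?Pg ?BPg//.
  by rewrite linearDl linearZl_LR/= !bE ?Pg ?BPg.
have phig z : z \in g -> phi z \in g by move=> zg; apply/aing/phi_mem.
rewrite [RHS]ip_bilin.2 ?phig// !H// (itw_sym B_itw) ?Pa//.
by rewrite [ip (P y) _]ip_bilin.2 ?Pg// [ip (B _) _]ip_bilin.2 ?Pg ?BPg.
Qed.

(** The subtracted term of the metric is beta0 <phi x, P y>, and P may be dropped
    because phi x lies in a. *)
Lemma form_betaE x y : x \in g -> y \in g ->
  form_beta a ip beta0 B x y = beta0 * ip (x - phi x) y.
Proof.
move=> xg yg; have [b bE] := form_extension ip_bilin.
have E : B (P x) + beta0 *: P x = beta0 *: phi x.
  by rewrite /IBP scalerDr scalerA mulfV// scale1r addrC.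
have phig := aing (phi_mem xg).
have Pyg : P y \in g by apply/aing/(orth_proj_mem ip_bilin ag).
have -> : ip (x - phi x) y = ip x y - ip (phi x) (P y).
  rewrite -bE ?rpredB// linearBl/= !bE//; congr (_ - _).
  rewrite ip_bilin.2// -(ip_orth_projl ip_bilin ag) ?phi_mem//.
  by rewrite ip_bilin.2.
by rewrite /form_beta E mulrBr -!bE ?memvZ// linearZl_LR.
Qed.

(** If phi x = x then x lies in a, so P x = x and B x = 0. *)
Lemma phi_fix0 x : set_inj [set` a] B -> x \in g -> phi x = x -> x = 0.
Proof.
move=> Binj xg phix; have xa : x \in a by rewrite -phix phi_mem.
have Ba := itw_stable B_itw.
move: phix; rewrite /IBP (orth_proj_id ip_bilin ag)// => /eqP.
rewrite -subr_eq0 addrAC subrr add0r scaler_eq0 invr_eq0 (negbTE beta0_neq0)/=.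
move=> /eqP Bx.
have B0 : B 0 = 0.
  have := itw_linear B_itw (-1) (mem0v a) (mem0v a).
  by rewrite scaler0 addr0 scaleN1r addNr.
apply: Binj; last by rewrite Bx B0.
- exact: mem_set.
- by apply: mem_set; exact: mem0v.
Qed.

(** Derivative at 0 of the constant function t |-> <Ad x, Ad y>, with Ad taken along
    exp(tc). *)
Lemma ip_ad c x y : c \in g -> x \in g -> y \in g ->
  ip (mxbr c x) y = - ip x (mxbr c y).
Proof.
move=> cg xg yg.
have [b bE] := form_extension ip_bilin.
pose Ad (t : R) u := expm (t *: c) *m u *m expm (- (t *: c)).
have Ad0 u : Ad 0 u = u by rewrite /Ad scale0r oppr0 expm0 mul1mx mulmx1.
have cb : continuous (fun p => b p.1 p.2) by exact: mx_bilinear_continuous.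
have D := is_derive_bilin cb (is_derive_Ad c x 0) (is_derive_Ad c y 0).
have cst_b : (fun s => b (Ad s x) (Ad s y)) = cst (b x y).
  apply/funext => t; rewrite /Ad -invmx_expm /= !bE//.
  - by apply: ip_inv => //; apply: (lie_expm HG); rewrite memvZ.
  - by apply: (lie_Ad_mem HG) => //; apply: (lie_expm HG); rewrite memvZ.
  - by apply: (lie_Ad_mem HG) => //; apply: (lie_expm HG); rewrite memvZ.
have := is_derive_derive1 D; rewrite cst_b derive1_cst -/(Ad 0 x) -/(Ad 0 y) !Ad0.
have cxg := lie_br HG cg xg; have cyg := lie_br HG cg yg.
by rewrite !bE// => /esym/eqP; rewrite addrC addr_eq0 => /eqP.
Qed.

(** Both sides are derivatives at 0 of the two members of [phi_Ad] along exp(tn). *)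
Lemma phi_ad n x : n \in a -> x \in g -> phi (mxbr n x) = mxbr n (phi x).
Proof.
move=> na xg; have ng := aing na.
have [L LE] := linear_extension phi_linear.
have Ad0 u : expm (0 *: n) *m u *m expm (- (0 *: n)) = u.
  by rewrite scale0r oppr0 expm0 mul1mx mulmx1.
have cL : continuous L by exact: mx_linear_continuous.
have D1 := is_derive_linear cL (is_derive_Ad n x 0).
have D2 := is_derive_Ad n (phi x) 0.
have E : L \o (fun s => expm (s *: n) *m x *m expm (- (s *: n))) =
    fun s => expm (s *: n) *m phi x *m expm (- (s *: n)).
  apply/funext => t; rewrite /= -invmx_expm LE ?phi_Ad//.
    by apply: (lie_expm HA); rewrite memvZ.
  by apply: (lie_Ad_mem HG) => //; apply: (lie_expm HG); rewrite memvZ.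
have := is_derive_derive1 D1; rewrite E (is_derive_derive1 D2) !Ad0 => ->.
by rewrite LE//; exact: (lie_br HG).
Qed.

End Phi.

(** * Vector fields in the left-invariant frame *)

Section LeftInvariantConnection.
Context {R : realType} {N : nat} {G : set 'M[R]_N} {g : {vspace 'M[R]_N}}.
Hypothesis HG : connected_lie_subgroup G g.
Implicit Types (X A : 'M[R]_N) (Y Z W : 'M[R]_N -> 'M[R]_N).

(** The g-valued function z of a vector field Z X = X z(X). *)
Definition body Z X := invmx X *m Z X.

Lemma bodyK Z X : G X -> X *m body Z X = Z X.
Proof. by move=> GX; rewrite /body mulKVmx ?(lie_unit HG). Qed.

Lemma body_mem Z X : vector_field G g Z -> G X -> body Z X \in g.
Proof. by move=> [_ TZ] GX; apply/(tangentP HG) => //; exact: TZ. Qed.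

Lemma smooth_mulmx (f h : 'M[R]_N -> 'M[R]_N) : smooth_on G g f -> smooth_on G g h ->
  smooth_on G g (fun X => f X *m h X).
Proof.
by move=> Sf Sh k; apply: (Ck_bilin HG (@mx_bilinear_continuous _ _ _ _ _ _ _)).
Qed.

Lemma smooth_body Z : vector_field G g Z -> smooth_on G g (body Z).
Proof.
by move=> [SZ _]; apply: smooth_mulmx => //; move=> k; exact: (Ck_inv HG).
Qed.

Lemma left_invariant_field A : A \in g -> vector_field G g (fun X => X *m A).
Proof.
move=> Ag; split=> [k|X GX]; last exact: tangent_mul.
apply: (Ck_lin HG (L := mulmxr A)); [exact: mx_linear_continuous|exact: (Ck_id HG)].
Qed.

Lemma smooth_is_derive (V : normedModType R) (f : 'M[R]_N -> V) X A :
  smooth_on G g f -> G X -> A \in g ->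
  is_derive (0 : R) (1 : R) (fun t => f (X *m expm (t *: A))) (dirD f X (X *m A)).
Proof. by move=> Sf GX Ag; exact: (Ck_is_derive HG GX Ag (Sf 1%N)). Qed.

Lemma dirD_body_mem Z X A : vector_field G g Z -> G X -> A \in g ->
  dirD (body Z) X (X *m A) \in g.
Proof.
move=> FZ GX Ag.
apply: is_derive_vspace (smooth_is_derive (smooth_body FZ) GX Ag) => t.
by apply: body_mem => //; apply: (lie_chart HG) => //; rewrite memvZ.
Qed.

Lemma expm_curve_derive0 X A :
  is_derive (0 : R) (1 : R) (fun t => X *m expm (t *: A)) (X *m A).
Proof.
have := is_derive_mulmxl X (is_derive_expm A 0).
by rewrite scale0r expm0 mulmx1.
Qed.

(** Product rule for Z X = X z(X). *)
Lemma dirD_field Z X A : vector_field G g Z -> G X -> A \in g ->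
  dirD Z X (X *m A) = X *m (A *m body Z X + dirD (body Z) X (X *m A)).
Proof.
move=> FZ GX Ag; apply: (dirD_eq HG) => //.
have -> : (fun t : R => Z (X *m expm (t *: A))) =
    fun t => (X *m expm (t *: A)) *m body Z (X *m expm (t *: A)).
  apply/funext => t; rewrite bodyK//; apply: (lie_chart HG) => //.
  by rewrite memvZ.
have := is_derive_mulmx (expm_curve_derive0 X A) (smooth_is_derive (smooth_body FZ) GX Ag).
by rewrite scale0r expm0 mulmx1 mulmxDr mulmxA addrC.
Qed.

Lemma dirD_linear (V : normedModType R) (f : 'M[R]_N -> V) X k A C :
  smooth_on G g f -> G X -> A \in g -> C \in g ->
  dirD f X (X *m (k *: A + C)) = k *: dirD f X (X *m A) + dirD f X (X *m C).
Proof.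
move=> Sf GX Ag Cg; have Df := Ck_chart_diff GX (Sf 1%N).
by rewrite !(dirD_chart HG GX _ Df) ?rpredD ?memvZ// linearP.
Qed.

Lemma smooth_scale (V : normedModType R) (f : 'M[R]_N -> R^o) (h : 'M[R]_N -> V) :
  smooth_on G g f -> smooth_on G g h -> smooth_on G g (fun X => f X *: h X).
Proof.
move=> Sf Sh k.
apply: (Ck_bilin HG (b := @scaleop R V)) => //.
exact: scale_continuous.
Qed.

Lemma is_derive_scale (V : normedModType R) (f : R -> R^o) (h : R -> V) (t : R) df dh :
  is_derive t (1 : R) f df -> is_derive t (1 : R) h dh ->
  is_derive t (1 : R) (fun s => f s *: h s) (f t *: dh + df *: h t).
Proof.
apply: (is_derive_bilin (b := @scaleop R V)).
exact: scale_continuous.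
Qed.

(** By differentiability dirD Z X (X A) is linear in A, so that it can be expanded
    in a basis of g with smooth coefficients; C^k regularity of each term uses
    that Z is C^(k+1). *)
Lemma smooth_dirD Y Z : vector_field G g Y -> smooth_on G g Z ->
  smooth_on G g (fun X => dirD Z X (Y X)).
Proof.
move=> FY SZ k.
pose e := vbasis g.
apply: (Ck_ext HG (f := fun X => \sum_(i < \dim g)
    coord e i (projv g (body Y X)) *: 'd (in_chart g Z X) 0 e`_i)).
  move=> X GX; have Yg := body_mem FY GX.
  rewrite -[in RHS](bodyK Y GX) (dirD_chart HG GX Yg (Ck_chart_diff GX (SZ 1%N))).
  rewrite [in RHS](coord_vbasis Yg) linear_sum/=; apply: eq_bigr => i _.
  by rewrite linearZ projv_id.
elim: (index_enum _) => [|i s IH].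
  apply: (Ck_ext HG (f := cst 0)) => [X GX|]; first by rewrite big_nil.
  exact: (Ck_cst HG).
apply: (Ck_ext HG (f := fun X => coord e i (projv g (body Y X)) *:
    'd (in_chart g Z X) 0 e`_i + \sum_(j <- s)
    coord e j (projv g (body Y X)) *: 'd (in_chart g Z X) 0 e`_j)).
  by move=> X GX; rewrite big_cons.
apply: (Ck_add HG) => //.
apply: (Ck_bilin HG (b := @scaleop R 'M[R]_N)).
- exact: scale_continuous.
- pose L : {linear 'M[R]_N -> R^o} := coord e i \o projv g.
  apply: (Ck_lin HG (L := L)); first exact: mx_linear_continuous.
  exact: smooth_body.
- apply: (Ck_diff HG); last exact: SZ.
  by apply: vbasis_mem; apply: memt_nth.
Qed.

End LeftInvariantConnection.

(** * The Levi-Civita connection of a left-invariant metric *)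

Section LeviCivita.
Context {R : realType} {N : nat} {G : set 'M[R]_N} {g : {vspace 'M[R]_N}}.
Hypothesis HG : connected_lie_subgroup G g.
Implicit Types (X A : 'M[R]_N) (Y Z W : 'M[R]_N -> 'M[R]_N).

(** The Christoffel function of nabla_Y Z = X (D_Y z + S y z): the term y z is
    the difference between the derivatives of Z = X z and of z. *)
Definition lcGamma (S : 'M[R]_N -> 'M[R]_N -> 'M[R]_N) X xi eta :=
  X *m (S (invmx X *m xi) (invmx X *m eta) - invmx X *m xi *m (invmx X *m eta)).

Definition lcNabla S Y Z X := dirD Z X (Y X) + lcGamma S X (Y X) (Z X).

Variables (m : 'M[R]_N -> 'M[R]_N -> R) (mb : {bilinear 'M[R]_N -> 'M[R]_N -> R^o}).
Hypothesis mbE : forall x y, x \in g -> y \in g -> mb x y = m x y.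
Hypothesis m_sym : forall x y, x \in g -> y \in g -> m x y = m y x.
Hypothesis m_nondeg : nondegenerate_on g m.

Section Existence.
Variable S : {bilinear 'M[R]_N -> 'M[R]_N -> 'M[R]_N}.
Hypothesis S_mem : forall x y, x \in g -> y \in g -> S x y \in g.
Hypothesis S_torsion : forall x y, x \in g -> y \in g -> S x y - S y x = mxbr x y.
Hypothesis S_skew : forall x y z, x \in g -> y \in g -> z \in g ->
  m (S x y) z + m y (S x z) = 0.

Lemma lcNablaE Y Z X : vector_field G g Y -> vector_field G g Z -> G X ->
  lcNabla S Y Z X = X *m (dirD (body Z) X (Y X) + S (body Y X) (body Z X)).
Proof.
move=> FY FZ GX; have Yg := body_mem HG FY GX.
rewrite /lcNabla /lcGamma -/(body Y X) -/(body Z X) -(bodyK HG Y GX).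
rewrite (dirD_field HG FZ GX Yg) -mulmxDr; congr (_ *m _).
by rewrite addrC addrA subrK addrC.
Qed.

Lemma lcNabla_field Y Z : vector_field G g Y -> vector_field G g Z ->
  vector_field G g (lcNabla S Y Z).
Proof.
move=> FY FZ; split=> [k|X GX]; last first.
  rewrite (lcNablaE FY FZ GX); apply: tangent_mul.
  rewrite rpredD ?S_mem ?(body_mem HG)//.
  rewrite -(bodyK HG Y GX); apply: (dirD_body_mem HG) => //; exact: (body_mem HG).
have [SZ _] := FZ.
apply: (Ck_add HG); first exact: (smooth_dirD HG).
have Sb (U V : 'M[R]_N -> 'M[R]_N) (b : {bilinear 'M[R]_N -> 'M[R]_N -> 'M[R]_N}) :
    Ck_on G g k U -> Ck_on G g k V -> Ck_on G g k (fun X => b (U X) (V X)).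
  by apply: (Ck_bilin HG); exact: mx_bilinear_continuous.
have SbY := smooth_body HG FY k; have SbZ := smooth_body HG FZ k.
apply: (Sb _ _ (@mulmx _ _ _ _)); first exact: (Ck_id HG).
apply: (Ck_add HG); first exact: Sb.
apply: (Ck_lin HG (L := -%R)) => [|]; first exact: mx_linear_continuous.
exact: (Sb _ _ (@mulmx _ _ _ _)).
Qed.

Lemma lcGamma_linearl X k xi xi' eta :
  lcGamma S X (k *: xi + xi') eta = k *: lcGamma S X xi eta + lcGamma S X xi' eta.
Proof.
rewrite /lcGamma [invmx X *m (_ + _)]mulmxDr -scalemxAr linearPl mulmxDl -scalemxAl opprD addrACA.
by rewrite -scalerBr mulmxDr -scalemxAr.
Qed.

Lemma lcGamma_linearr X k xi eta eta' :
  lcGamma S X xi (k *: eta + eta') = k *: lcGamma S X xi eta + lcGamma S X xi eta'.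
Proof.
rewrite /lcGamma [invmx X *m (_ + _)]mulmxDr -scalemxAr linearPr mulmxDr -scalemxAr opprD addrACA.
by rewrite -scalerBr mulmxDr -scalemxAr.
Qed.

Lemma lcNabla_connection : affine_connection G g (lcNabla S).
Proof.
split.
- move=> Y Y' Z Z' FY FY' FZ FZ' YY' ZZ' X GX; have GX' := set_mem GX.
  rewrite /lcNabla YY'// ZZ'//; congr (_ + _).
  rewrite -(bodyK HG Y' GX'); apply: (dirD_ext HG) => //.
    exact: (body_mem HG).
  by move=> X' GX''; apply/ZZ'/mem_set.
- exact: lcNabla_field.
- move=> f Y Y' Z Sf FY FY' FZ X /set_mem GX.
  have Yg := body_mem HG FY GX; have Yg' := body_mem HG FY' GX.
  rewrite /lcNabla lcGamma_linearl -(bodyK HG Y GX) -(bodyK HG Y' GX).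
  rewrite scalemxAr -mulmxDr (dirD_linear HG) //; last by case: FZ.
  move: (dirD _ _ _) (dirD _ _ _) (lcGamma _ _ _ _) (lcGamma _ _ _ _) => d d' c c'.
  by rewrite scalerDr addrACA.
- move=> Y Z Z' FY FZ FZ' X /set_mem GX.
  have Yg := body_mem HG FY GX; have [SZ _] := FZ; have [SZ' _] := FZ'.
  have := lcGamma_linearr X 1 (Y X) (Z X) (Z' X); rewrite !scale1r => GE.
  rewrite /lcNabla GE addrACA; congr (_ + _); rewrite -(bodyK HG Y GX).
  apply: (dirD_eq HG) => //.
  by apply: is_deriveD; exact: (smooth_is_derive HG).
- move=> f Y Z Sf FY FZ X /set_mem GX.
  have Yg := body_mem HG FY GX; have [SZ _] := FZ.
  rewrite /lcNabla -[f X *: Z X]addr0 lcGamma_linearr.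
  have -> : lcGamma S X (Y X) 0 = 0.
    by rewrite /lcGamma !mulmx0 linear0r subrr mulmx0.
  rewrite addr0 scalerDr addrA; congr (_ + _); rewrite -(bodyK HG Y GX).
  apply: (dirD_eq HG) => //.
  have := is_derive_scale (smooth_is_derive HG Sf GX Yg) (smooth_is_derive HG SZ GX Yg).
  by rewrite scale0r expm0 mulmx1 addrC.
Qed.

Lemma metric_body Y Z X :
  left_invariant_metric m X (Y X) (Z X) = m (body Y X) (body Z X).
Proof. by []. Qed.

Lemma body_lcNabla Y Z X : vector_field G g Y -> vector_field G g Z -> G X ->
  body (lcNabla S Y Z) X = dirD (body Z) X (Y X) + S (body Y X) (body Z X).
Proof.
by move=> FY FZ GX; rewrite {1}/body lcNablaE// mulKmx ?(lie_unit HG).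
Qed.

(** Any bilinear S with torsion S x y - S y x = [x, y] and values in the
    antisymmetric operators of the metric gives the Levi-Civita connection. *)
Theorem lcNabla_levi_civita : levi_civita G g (left_invariant_metric m) (lcNabla S).
Proof.
split; first exact: lcNabla_connection.
- move=> Y Z FY FZ X /set_mem GX.
  have Yg := body_mem HG FY GX; have Zg := body_mem HG FZ GX.
  rewrite /lcNabla opprD addrACA -[RHS]addr0; congr (_ + _).
  rewrite /lcGamma -/(body Y X) -/(body Z X) -mulmxBr opprD opprK addrACA S_torsion//.
  by rewrite /mxbr addrACA subrr addNr addr0 mulmx0.
- move=> Y Z W FY FZ FW X /set_mem GX.
  have Yg := body_mem HG FY GX; have Zg := body_mem HG FZ GX.
  have Wg := body_mem HG FW GX.
  rewrite !(metric_body (lcNabla S _ _)) !(metric_body _ (lcNabla S _ _)).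
  rewrite !body_lcNabla// -(bodyK HG Y GX).
  set y := body Y X; have dZg := dirD_body_mem HG FZ GX Yg.
  have dWg := dirD_body_mem HG FW GX Yg.
  transitivity (mb (body Z X) (dirD (body W) X (X *m y)) +
                mb (dirD (body Z) X (X *m y)) (body W X)).
    apply: (dirD_eq HG) => //.
    have -> : (fun t : R => left_invariant_metric m (X *m expm (t *: y))
        (Z (X *m expm (t *: y))) (W (X *m expm (t *: y))) : R^o) =
        fun t => mb (body Z (X *m expm (t *: y))) (body W (X *m expm (t *: y))).
      apply/funext => t; have GXt : G (X *m expm (t *: y)).
        by apply: (lie_chart HG) => //; rewrite memvZ.
      by rewrite mbE ?(body_mem HG).
    have cmb : continuous (fun p => mb p.1 p.2) by exact: mx_bilinear_continuous.
    have := is_derive_bilin cmb (smooth_is_derive HG (smooth_body HG FZ) GX Yg)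
      (smooth_is_derive HG (smooth_body HG FW) GX Yg).
    by rewrite scale0r expm0 mulmx1.
  have SZg := S_mem Yg Zg; have SWg := S_mem Yg Wg.
  have Sk := S_skew Yg Zg Wg; rewrite -!mbE// in Sk.
  move: (dirD _ _ _) (dirD _ _ _) dZg dWg => dW dZ dZg dWg.
  rewrite -!mbE ?rpredD// linearDl linearDr/=.
  by rewrite [RHS]addrACA Sk addr0 addrC.
Qed.

End Existence.

(** With T = <nabla_Y Z - nabla'_Y Z, W>, six alternating uses of symmetry in Y, Z
    and antisymmetry in Z, W give T = - T.  Taking for W the left-invariant fields
    suffices, so the argument is pointwise and needs no extension of vectors. *)
Lemma levi_civita_unique nabla nabla' :
  levi_civita G g (left_invariant_metric m) nabla ->
  levi_civita G g (left_invariant_metric m) nabla' ->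
  forall Y Z, vector_field G g Y -> vector_field G g Z ->
  {in G, nabla Y Z =1 nabla' Y Z}.
Proof.
move=> [CN TN MN] [CN' TN' MN'].
pose D Y Z X := body (nabla Y Z) X - body (nabla' Y Z) X.
have Dg Y Z X : vector_field G g Y -> vector_field G g Z -> G X -> D Y Z X \in g.
  move=> FY FZ GX; have F1 := conn_field CN FY FZ; have F2 := conn_field CN' FY FZ.
  by rewrite rpredB ?(body_mem HG).
have Dsym Y Z X : vector_field G g Y -> vector_field G g Z -> G X -> D Y Z X = D Z Y X.
  move=> FY FZ GX; have GX' := mem_set GX.
  apply/eqP; rewrite -subr_eq0 /D /body -!mulmxBr.
  have -> : nabla Y Z X - nabla' Y Z X - (nabla Z Y X - nabla' Z Y X) =
      (nabla Y Z X - nabla Z Y X) - (nabla' Y Z X - nabla' Z Y X).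
    by rewrite !opprD !opprK addrACA.
  by rewrite TN// TN'// subrr mulmx0.
have Dskew Y Z W X : vector_field G g Y -> vector_field G g Z -> vector_field G g W ->
    G X -> m (D Y Z X) (body W X) = - m (D Y W X) (body Z X).
  move=> FY FZ FW GX; have GX' := mem_set GX.
  have Zg := body_mem HG FZ GX; have Wg := body_mem HG FW GX.
  have N1 := body_mem HG (conn_field CN FY FZ) GX.
  have N2 := body_mem HG (conn_field CN' FY FZ) GX.
  have N3 := body_mem HG (conn_field CN FY FW) GX.
  have N4 := body_mem HG (conn_field CN' FY FW) GX.
  have := MN Y Z W FY FZ FW X GX'; rewrite (MN' Y Z W FY FZ FW X GX').
  rewrite /left_invariant_metric -!/(body _ X) => E.
  rewrite [m (D Y W X) _]m_sym ?Dg// /D -!mbE ?rpredB// linearBl linearBr/=.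
  rewrite !mbE// opprB; apply/eqP; rewrite subr_eq addrAC eq_sym subr_eq.
  by rewrite [X in X == _]addrC E.
move=> Y Z FY FZ X GX'; have GX := set_mem GX'.
suff D0 : D Y Z X = 0.
  rewrite -(bodyK HG (nabla Y Z) GX) -(bodyK HG (nabla' Y Z) GX).
  by congr (_ *m _); apply/eqP; rewrite -subr_eq0; apply/eqP.
apply: m_nondeg => [|A Ag]; first exact: Dg.
pose W X := X *m A; have FW := left_invariant_field HG Ag.
have -> : A = body W X by rewrite /body /W mulKmx ?(lie_unit HG).
have : m (D Y Z X) (body W X) = - m (D Y Z X) (body W X).
  rewrite {1}Dsym// Dskew// [D Z W X]Dsym// Dskew// opprK.
  by rewrite [D W Y X]Dsym// Dskew.
by move/eqP; rewrite -subr_eq0 opprK -mulr2n mulrn_eq0/= => /eqP.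
Qed.

End LeviCivita.

(** * Derivative of the inverse of a curve of matrices *)

Section InverseCurve.
Context {R : realType} {N : nat}.

(** The determinant is a polynomial in the entries. *)
Lemma derivable_det n (f : R -> 'M[R]_n) (t : R) :
  (forall i j, derivable (fun s => f s i j) t 1) -> derivable (fun s => \det (f s)) t 1.
Proof.
move=> Df.
have -> : (fun s => \det (f s)) =
    \sum_(p : 'S_n) (fun s => (-1) ^+ p * \prod_i f s i (p i)).
  by apply/funext => s; rewrite fct_sumE.
elim/big_ind : _ => [|u v Du Dv|p _]; [exact: derivable_cst|exact: derivableD|].
apply: derivableM; first exact: derivable_cst.
have -> : (fun s => \prod_i f s i (p i)) = \prod_i (fun s => f s i (p i)).
  by apply/funext => s; rewrite fct_prodE.
elim/big_ind : _ => [|u v Du Dv|i _]; [exact: derivable_cst|exact: derivableM|].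
exact: Df.
Qed.

Lemma derivable_invmx (f : R -> 'M[R]_N) (t : R) :
  (forall s, f s \in unitmx) -> derivable f t 1 -> derivable (fun s => invmx (f s)) t 1.
Proof.
move=> Uf /derivable_mxP Df; apply/derivable_mxP => i j.
have -> : (fun s => invmx (f s) i j) =
    (fun s => (\det (f s))^-1) * (fun s => cofactor (f s) j i).
  by apply/funext => s; rewrite /invmx Uf !mxE.
apply: derivableM.
  apply: derivableV; last exact: derivable_det.
  by have := Uf t; rewrite unitmxE unitfE.
apply: derivableM; first exact: derivable_cst.
apply: derivable_det => k l.
rewrite (_ : (fun s => _) = (fun s => f s (lift j k) (lift i l))) //.
by apply/funext => s; rewrite !mxE.
Qed.

Lemma is_derive_invmx (f : R -> 'M[R]_N) (t : R) df :
  (forall s, f s \in unitmx) -> is_derive t (1 : R) f df ->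
  is_derive t (1 : R) (fun s => invmx (f s)) (- (invmx (f t) *m df *m invmx (f t))).
Proof.
move=> Uf Df; have Hd : derivable f t 1 by case: Df.
have Di := derivable_derive1 (derivable_invmx Uf Hd).
have D1 := is_derive_mulmx Df Di.
have E1 : (fun s => f s *m invmx (f s)) = cst 1%:M.
  by apply/funext => s; rewrite mulmxV.
have := is_derive_derive1 D1; rewrite E1 derive1_cst => /esym/eqP.
rewrite addr_eq0 => /eqP E.
suff -> : - (invmx (f t) *m df *m invmx (f t)) = derive1 (fun s => invmx (f s)) t by [].
by rewrite -mulmxA -mulmxN -E mulKmx.
Qed.

End InverseCurve.

(** * Geodesics and parallel transport *)

Section Transport.
Context {R : realType} {N : nat} {G : set 'M[R]_N} {g : {vspace 'M[R]_N}}.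
Hypothesis HG : connected_lie_subgroup G g.
Variable L : {linear 'M[R]_N -> 'M[R]_N}.
Hypothesis L_mem : forall x, x \in g -> L x \in g.
Hypothesis L_Ad : forall x y t, x \in g -> y \in g ->
  L (expm (t *: L x) *m y *m expm (- (t *: L x))) =
  expm (t *: L x) *m L y *m expm (- (t *: L x)).
Hypothesis L_ad : forall x y, x \in g -> y \in g -> L (mxbr (L x) y) = mxbr (L x) (L y).

(** Half of ad_x, corrected by the terms which make it antisymmetric for the metric
    instead of the bi-invariant form. *)
Definition conn_op x y := 2^-1 *: (mxbr x y + mxbr (L x) y + mxbr (L y) x).

Lemma conn_op_is_bilinear : bilinear_for
  (GRing.Scale.Law.clone _ _ *:%R _) (GRing.Scale.Law.clone _ _ *:%R _) conn_op.
Proof.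
have E k (a1 a2 a3 b1 b2 b3 : 'M[R]_N) :
    2^-1 *: (k *: a1 + b1 + (k *: a2 + b2) + (k *: a3 + b3)) =
    k *: (2^-1 *: (a1 + a2 + a3)) + 2^-1 *: (b1 + b2 + b3).
  rewrite (addrACA (k *: a1)) (addrACA (_ + _)) -!scalerDr [k *: (_ *: _)]scalerA.
  by rewrite [k * _]mulrC -scalerA -scalerDr.
by split=> [u'|u] k x y; rewrite /conn_op /= linearP !linearPl !linearPr /= -E.
Qed.

HB.instance Definition _ := bilinear_isBilinear.Build R 'M[R]_N 'M[R]_N 'M[R]_N
  _ _ conn_op conn_op_is_bilinear.

(** The operator which [expv] integrates in the formula for parallel transport. *)
Definition transport_op V C := 2^-1 *: (mxbr C V + mxbr (L V) C - mxbr (L C) V).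

(** What remains of - S V, with S = [conn_op], in a frame which is conjugated by
    exp(t L V). *)
Lemma transport_opE V C : transport_op V C = mxbr (L V) C - conn_op V C.
Proof.
have half (v : 'M[R]_N) : v = 2^-1 *: (v + v).
  by rewrite -[v + v]mulr2n -[v *+ 2]scaler_nat scalerA mulVf ?scale1r// pnatr_eq0.
rewrite /transport_op /conn_op [mxbr C V]mxbrC [X in _ = X - _]half -scalerBr; congr (_ *: _).
move: (mxbr V C) (mxbr (L V) C) (mxbr (L C) V) => s l r.
by rewrite [s + l]addrC -(addrA l s r) opprD addrACA subrr add0r opprD addrA [l - s]addrC.
Qed.

Lemma transport_op_is_linear V : linear (transport_op V).
Proof.
move=> k x y; rewrite !transport_opE linearPr linearPr /= opprD addrACA.
by rewrite -scalerBr.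
Qed.

HB.instance Definition _ V := GRing.isLinear.Build R 'M[R]_N 'M[R]_N _ (transport_op V) (transport_op_is_linear V).

Lemma conn_op_mem x y : x \in g -> y \in g -> conn_op x y \in g.
Proof.
by move=> xg yg; rewrite /conn_op memvZ// rpredD ?(lie_br HG) ?L_mem// rpredD ?(lie_br HG) ?L_mem.
Qed.

Lemma transport_op_mem V x : V \in g -> x \in g -> transport_op V x \in g.
Proof.
by move=> Vg xg; rewrite /transport_op memvZ// rpredB ?(lie_br HG) ?L_mem// rpredD ?(lie_br HG) ?L_mem.
Qed.

Lemma conn_op_torsion x y : conn_op x y - conn_op y x = mxbr x y.
Proof.
rewrite /conn_op -scalerBr.
have -> : mxbr x y + mxbr (L x) y + mxbr (L y) x - (mxbr y x + mxbr (L y) x + mxbr (L x) y)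
   = 2 *: mxbr x y.
  rewrite [mxbr y x + _ + _]addrAC -(addrA (mxbr x y)) -(addrA (mxbr y x)).
  by rewrite opprD addrACA subrr addr0 [mxbr y x]mxbrC opprK scaler_nat mulr2n.
by rewrite scalerA mulVf ?scale1r// pnatr_eq0.
Qed.

Section Frame.
Variable (Gam : 'M[R]_N -> 'M[R]_N -> 'M[R]_N -> 'M[R]_N).
Hypothesis GamE : forall X xi eta, G X -> tangent g X xi -> tangent g X eta ->
  Gam X xi eta = lcGamma conn_op X xi eta.

(** The covariant derivative in the left-invariant frame: for W = c w it is
    c (w' + S v w) with v = c^-1 c'. *)
Lemma is_derive_body (c W : R -> 'M[R]_N) (t : R) :
  (forall s, G (c s)) -> derivable c t 1 -> derivable W t 1 ->
  tangent g (c t) (derive1 c t) -> tangent g (c t) (W t) ->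
  is_derive t (1 : R) (fun s => invmx (c s) *m W s)
    (invmx (c t) *m covD Gam c W t -
     conn_op (invmx (c t) *m derive1 c t) (invmx (c t) *m W t)).
Proof.
move=> Gc Dc DW Tc TW; have Uc s : c s \in unitmx by exact: (lie_unit HG).
have := is_derive_mulmx (is_derive_invmx Uc (derivable_derive1 Dc)) (derivable_derive1 DW).
suff -> : invmx (c t) *m covD Gam c W t -
     conn_op (invmx (c t) *m derive1 c t) (invmx (c t) *m W t) =
  invmx (c t) *m derive1 W t + - (invmx (c t) *m derive1 c t *m invmx (c t)) *m W t by [].
rewrite /covD GamE// /lcGamma mulmxDr mulKmx// -addrA; congr (_ + _).
by rewrite addrAC subrr add0r mulNmx !mulmxA.
Qed.

Lemma covD_eq0 (c W : R -> 'M[R]_N) (t : R) dw :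
  (forall s, G (c s)) -> derivable c t 1 -> derivable W t 1 ->
  tangent g (c t) (derive1 c t) -> tangent g (c t) (W t) ->
  is_derive t (1 : R) (fun s => invmx (c s) *m W s) dw ->
  (covD Gam c W t = 0 <->
   dw = - conn_op (invmx (c t) *m derive1 c t) (invmx (c t) *m W t)).
Proof.
move=> Gc Dc DW Tc TW Dw.
have := is_derive_derive1 (is_derive_body Gc Dc DW Tc TW).
rewrite (is_derive_derive1 Dw) => ->.
have Uc : c t \in unitmx by exact: (lie_unit HG).
split=> [->|/eqP]; first by rewrite mulmx0 add0r.
rewrite -subr_eq0 opprK subrK => /eqP E.
by rewrite -[LHS](mulKVmx Uc) E mulmx0.
Qed.

End Frame.

Section ClosedForm.
Variables (X V : 'M[R]_N).
Hypothesis GX : G X.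
Hypothesis Vg : V \in g.
Let n := L V.
Let k := - L V + V.

Definition exp_geodesic (t : R) := X *m expm (t *: k) *m expm (t *: n).
(** The field with coordinate curve E in the frame transported along the geodesic;
    the velocity is the case where E is constantly V. *)
Definition field_along (E : R -> 'M[R]_N) (t : R) :=
  X *m expm (t *: k) *m E t *m expm (t *: n).
Let Ad t x := expm (- (t *: n)) *m x *m expm (t *: n).

Lemma exp_geodesic_mem t : G (exp_geodesic t).
Proof.
apply: (lie_chart HG); last by rewrite memvZ ?L_mem.
by apply: (lie_chart HG) => //; rewrite memvZ ?rpredD ?rpredN ?L_mem.
Qed.

Lemma is_derive_along (E : R -> 'M[R]_N) t dE : is_derive t (1 : R) E dE ->
  is_derive t (1 : R) (field_along E)
    (X *m expm (t *: k) *m (k *m E t + dE + E t *m n) *m expm (t *: n)).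
Proof.
move=> DE; rewrite /field_along; move: (k) (n) => k0 n0.
have D1 := is_derive_mulmxl X (is_derive_expm k0 t).
have D := is_derive_mulmx (is_derive_mulmx D1 DE) (is_derive_expm n0 t).
suff -> : X *m expm (t *: k0) *m (k0 *m E t + dE + E t *m n0) *m expm (t *: n0) =
  X *m expm (t *: k0) *m E t *m (n0 *m expm (t *: n0)) +
   (X *m expm (t *: k0) *m dE + X *m (k0 *m expm (t *: k0)) *m E t) *m expm (t *: n0) by [].
rewrite (expm_scale_comm k0) !mulmxDr !mulmxDl !mulmxA.
by rewrite [RHS]addrC [X in _ = X + _]addrC.
Qed.

(** Derivatives of [field_along] of K E are again of this form, with K replaced by
    C |-> k K C + K (Q C) + K C n. *)
Lemma smooth_along (E : R -> 'M[R]_N) (Q : {linear 'M[R]_N -> 'M[R]_N}) :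
  (forall t, is_derive t (1 : R) E (Q (E t))) -> smooth_curve (field_along E).
Proof.
move=> DE.
have dK (K : {linear 'M[R]_N -> 'M[R]_N}) (t : R) : is_derive t (1 : R)
    (field_along (K \o E)) (field_along (((mulmx k \o K) \+ (K \o Q) \+ (mulmxr n \o K)) \o E) t).
  have D : is_derive t (1 : R) (K \o E) (K (Q (E t))).
    by apply: is_derive_linear => //; exact: mx_linear_continuous.
  exact: is_derive_along D.
have H j : exists K : {linear 'M[R]_N -> 'M[R]_N}, derive1n j (field_along E) = field_along (K \o E).
  elim: j => [|j [K IH]]; first by exists idfun.
  exists ((mulmx k \o K) \+ (K \o Q) \+ (mulmxr n \o K)).
  by rewrite derive1nS IH; apply/funext => t; exact: is_derive_derive1.
move=> j t; have [K ->] := H j; by case: (dK K t).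
Qed.

Lemma derive_exp_geodesic : derive1 exp_geodesic = field_along (cst V).
Proof.
have -> : exp_geodesic = field_along (cst 1%:M) by apply/funext => t; rewrite /field_along mulmx1.
apply/funext => t; apply: is_derive_derive1.
have := is_derive_along (is_derive_cst 1%:M t 1).
by rewrite mulmx1 addr0 mul1mx /k addrAC addNr add0r.
Qed.

Lemma smooth_exp_geodesic : smooth_curve exp_geodesic.
Proof.
have -> : exp_geodesic = field_along (cst 1%:M) by apply/funext => t; rewrite /field_along mulmx1.
exact: (smooth_along (Q := \0)).
Qed.

Lemma body_along E t : invmx (exp_geodesic t) *m field_along E t = Ad t (E t).
Proof.
have UX := lie_unit HG GX; have Uk := expm_unit (t *: k); have Un := expm_unit (t *: n).
have UG := lie_unit HG (exp_geodesic_mem t).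
suff -> : field_along E t = exp_geodesic t *m Ad t (E t) by rewrite mulKmx.
by rewrite /field_along /exp_geodesic /Ad !mulmxA -[_ *m expm (t *: n) *m expm (- _)]mulmxA expmNK mulmx1.
Qed.

Lemma Ad_mem t x : x \in g -> Ad t x \in g.
Proof.
move=> xg; have Gn : G (expm (- (t *: n))).
  by apply: (lie_expm HG); rewrite memvN memvZ ?L_mem.
by have := lie_Ad_mem HG Gn xg; rewrite invmx_expm opprK.
Qed.

Lemma L_AdN t x : x \in g -> L (Ad t x) = Ad t (L x).
Proof.
by move=> xg; have := L_Ad (- t) Vg xg; rewrite -/n scaleNr opprK.
Qed.

Lemma Ad_mxbr t x y : Ad t (mxbr x y) = mxbr (Ad t x) (Ad t y).
Proof.
have E u v : Ad t u *m Ad t v = Ad t (u *m v).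
  by rewrite /Ad !mulmxA -[_ *m expm (t *: n) *m expm (- _)]mulmxA expmNK mulmx1.
by rewrite /mxbr !E /Ad mulmxBr mulmxBl.
Qed.

Lemma Ad_n t : Ad t n = n.
Proof. by rewrite /Ad -mulmxA expm_scale_comm mulmxA expmNV mul1mx. Qed.

Lemma Ad_transport_op t x : x \in g -> Ad t (transport_op V x) = transport_op (Ad t V) (Ad t x).
Proof.
move=> xg.
have AdS u v w : Ad t (2^-1 *: (u + v - w)) = 2^-1 *: (Ad t u + Ad t v - Ad t w).
  by rewrite /Ad -scalemxAr -scalemxAl mulmxBr mulmxDr mulmxBl mulmxDl.
by rewrite /transport_op AdS !Ad_mxbr !L_AdN.
Qed.

Lemma Ad_inj t : injective (Ad t).
Proof.
have UE := expm_unit (t *: n); have UE' := expm_unit (- (t *: n)).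
by move=> x y /(congr1 (mulmx^~ (invmx (expm (t *: n)))));
   rewrite !mulmxK// => /(congr1 (mulmx (invmx (expm (- (t *: n)))))); rewrite !mulKmx.
Qed.

Lemma is_derive_Ad_along (E : R -> 'M[R]_N) (t : R) dE : is_derive t (1 : R) E dE ->
  is_derive t (1 : R) (fun s => Ad s (E s)) (mxbr (Ad t (E t)) n + Ad t dE).
Proof.
move=> DE; rewrite /Ad; move: (n) => n0.
have D := is_derive_mulmx (is_derive_mulmx (is_derive_expmN n0 t) DE) (is_derive_expm n0 t).
suff -> : mxbr (expm (- (t *: n0)) *m E t *m expm (t *: n0)) n0 +
    expm (- (t *: n0)) *m dE *m expm (t *: n0) =
  expm (- (t *: n0)) *m E t *m (n0 *m expm (t *: n0)) +
  (expm (- (t *: n0)) *m dE + - (n0 *m expm (- (t *: n0))) *m E t) *m expm (t *: n0) by [].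
rewrite expm_scale_comm /mxbr mulmxDl !mulNmx !mulmxA -addrA; congr (_ + _).
by rewrite addrC.
Qed.

Variable (Gam : 'M[R]_N -> 'M[R]_N -> 'M[R]_N -> 'M[R]_N).
Hypothesis GamE : forall X xi eta, G X -> tangent g X xi -> tangent g X eta ->
  Gam X xi eta = lcGamma conn_op X xi eta.

Lemma along_tangent (E : R -> 'M[R]_N) t : E t \in g -> tangent g (exp_geodesic t) (field_along E t).
Proof.
move=> Eg; apply/(tangentP HG); first exact: exp_geodesic_mem.
by rewrite body_along; exact: Ad_mem.
Qed.

(** The frame Ad_(exp (-t n)) absorbs the bracket with n, and [transport_op]
    commutes with the change of frame, which leaves an equation with constant coefficients. *)
Lemma along_parallel (E : R -> 'M[R]_N) t dE : E t \in g -> is_derive t (1 : R) E dE ->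
  (covD Gam exp_geodesic (field_along E) t = 0 <-> dE = transport_op V (E t)).
Proof.
move=> Eg DE.
have DW : derivable (field_along E) t 1 by case: (is_derive_along DE).
have Dc : derivable exp_geodesic t 1 by exact: (@smooth_exp_geodesic 0%N).
have Tc : tangent g (exp_geodesic t) (derive1 exp_geodesic t).
  by rewrite derive_exp_geodesic; exact: along_tangent.
have := is_derive_Ad_along DE.
have -> : (fun s => Ad s (E s)) = fun s => invmx (exp_geodesic s) *m field_along E s.
  by apply/funext => s; rewrite body_along.
move=> Dw; rewrite (covD_eq0 GamE exp_geodesic_mem Dc DW Tc (along_tangent Eg) Dw).
rewrite derive_exp_geodesic !body_along.
have -> : - conn_op (Ad t V) (Ad t (E t)) = mxbr (Ad t (E t)) n + Ad t (transport_op V (E t)).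
  rewrite Ad_transport_op// transport_opE L_AdN// -/n Ad_n addrA [mxbr _ n]mxbrC.
  by rewrite addNr add0r.
by split=> [/addrI/Ad_inj|->].
Qed.

Lemma exp_geodesic_geodesic : geodesic G g Gam exp_geodesic.
Proof.
split; first split; first exact: smooth_exp_geodesic.
  move=> t; split; first exact: exp_geodesic_mem.
  by rewrite derive_exp_geodesic; exact: along_tangent.
move=> t; rewrite derive_exp_geodesic.
apply/(along_parallel (E := cst V) _ (is_derive_cst V t 1)) => //.
by rewrite /transport_op /= /mxbr subrr add0r subrr scaler0.
Qed.

Lemma exp_geodesic0 : exp_geodesic 0 = X.
Proof. by rewrite /exp_geodesic !scale0r expm0 !mulmx1. Qed.

Lemma field_along0 E : field_along E 0 = X *m E 0.
Proof. by rewrite /field_along !scale0r expm0 !mulmx1. Qed.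

(** With v = c^-1 c', the quantity L v is conserved, which makes the geodesic equation linear. *)
Lemma geodesic_unique (c : R -> 'M[R]_N) : geodesic G g Gam c -> c 0 = X ->
  derive1 c 0 = X *m V -> c =1 exp_geodesic.
Proof.
move=> [[Sc HcT] Hc] c0 dc0.
have Gc t : G (c t) by case: (HcT t).
have Tc t : tangent g (c t) (derive1 c t) by case: (HcT t).
have UX := lie_unit HG GX.
have Uc t : c t \in unitmx by exact: (lie_unit HG).
have Dc t : is_derive t (1 : R) c (derive1 c t) by apply: derivable_derive1; exact: (Sc 0%N).
have Ddc t : derivable (derive1 c) t 1 by exact: (Sc 1%N).
pose v t := invmx (c t) *m derive1 c t.
have vg t : v t \in g by apply/(tangentP HG).
have Dv t : is_derive t (1 : R) v (mxbr (v t) (L (v t))).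
  have := is_derive_body GamE Gc (Sc 0%N t) (Ddc t) (Tc t) (Tc t).
  rewrite Hc mulmx0 add0r -/(v t) => D.
  suff -> : mxbr (v t) (L (v t)) = - conn_op (v t) (v t) by [].
  have lp0 : transport_op (v t) (v t) = 0.
    by rewrite /transport_op /mxbr subrr add0r subrr scaler0.
  have := transport_opE (v t) (v t); rewrite lp0 => /esym/eqP; rewrite subr_eq0 => /eqP <-; exact: mxbrC.
have v0 : v 0 = V by rewrite /v c0 dc0 mulKmx.
(* Conservation law: L [v, L v] = [L v, L v] = 0. *)
have Lv t : L (v t) = n.
  rewrite /n -v0; apply: (mx_is_derive0_cst (f := L \o v)) => u.
  have cL : continuous L by exact: mx_linear_continuous.
  have := is_derive_linear cL (Dv u).
  by rewrite mxbrC linearN/= L_ad// /mxbr subrr oppr0.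
(* Integration of v' = [v, n]. *)
have vE t : v t *m expm (- (t *: n)) = expm (- (t *: n)) *m V.
  pose f t := expm (t *: n) *m v t *m expm (- (t *: n)).
  have f0 : f t = f 0.
    apply: mx_is_derive0_cst => u.
    have := is_derive_mulmx (is_derive_mulmx (is_derive_expm n u) (Dv u)) (is_derive_expmN n u).
    rewrite Lv; suff -> : expm (u *: n) *m v u *m - (n *m expm (- (u *: n))) +
      (expm (u *: n) *m mxbr (v u) n + n *m expm (u *: n) *m v u) *m expm (- (u *: n)) = 0 by [].
    rewrite expm_scale_comm /mxbr mulmxBr mulmxN mulmxDl mulmxBl !mulmxA.
    by rewrite subrK addNr.
  have <- : f t = V by rewrite f0 /f scale0r oppr0 expm0 mul1mx mulmx1.
  by rewrite /f !mulmxA expmNV mul1mx.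
(* Integration of c' = c v in the frame moved by exp(-tn). *)
pose d t := c t *m expm (- (t *: n)).
have Dd t : is_derive t (1 : R) d (d t *m k).
  have := is_derive_mulmx (Dc t) (is_derive_expmN n t).
  suff -> : d t *m k = c t *m - (n *m expm (- (t *: n))) + derive1 c t *m expm (- (t *: n)) by [].
  have -> : derive1 c t = c t *m v t by rewrite /v mulKVmx.
  rewrite -(mulmxA (c t) (v t)) vE.
  have -> : n *m expm (- (t *: n)) = expm (- (t *: n)) *m n.
    by rewrite -scaleNr expm_scale_comm.
  by rewrite /d /k -/n mulmxDr !mulmxN !mulmxA.
move=> t; rewrite /exp_geodesic -[X]c0.
have -> : c 0 = d 0 by rewrite /d scale0r oppr0 expm0 mulmx1.
by rewrite -(right_ode_unique t Dd) /d -mulmxA expmNV mulmx1.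
Qed.

Lemma parallel_exists x : x \in g ->
  parallel g Gam exp_geodesic (field_along (fun t => expv (fun C => t *: transport_op V C) x)).
Proof.
move=> xg.
have DE t := is_derive_expv (transport_op V) x t.
have Eg t : expv (fun C => t *: transport_op V C) x \in g.
  by apply: (expv_mem (P := transport_op V)) => // C; exact: transport_op_mem.
split=> [|t|t].
- exact: (smooth_along (Q := transport_op V)).
- exact: along_tangent.
- exact/(along_parallel (Eg t) (DE t)).
Qed.

Lemma parallel_unique W : parallel g Gam exp_geodesic W ->
  W = field_along (fun t => expv (fun C => t *: transport_op V C) (invmx X *m W 0)).
Proof.
move=> [SW TW PW].
pose w t := invmx (exp_geodesic t) *m W t.
have wg t : w t \in g by apply/(tangentP HG) => //; exact: exp_geodesic_mem.
pose E t := expm (t *: n) *m w t *m expm (- (t *: n)).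
have EW : W = field_along E.
  apply/funext => t; have UG := lie_unit HG (exp_geodesic_mem t).
  rewrite -[LHS](mulKVmx UG) -[RHS](mulKVmx UG) body_along /Ad /E.
  congr (_ *m _).
  by rewrite !mulmxA expmNV mul1mx -mulmxA expmNV mulmx1.
have Eg t : E t \in g.
  rewrite /E -invmx_expm; apply: (lie_Ad_mem HG) => //.
  by apply: (lie_expm HG); rewrite memvZ ?L_mem.
have DE t : is_derive t (1 : R) E (transport_op V (E t)).
  have Dc : derivable exp_geodesic t 1 by exact: (@smooth_exp_geodesic 0%N).
  have Tc : tangent g (exp_geodesic t) (derive1 exp_geodesic t).
    by rewrite derive_exp_geodesic; exact: along_tangent.
  have Dw := is_derive_body GamE exp_geodesic_mem Dc (SW 0%N t) Tc (TW t).
  have DE := is_derive_mulmx (is_derive_mulmx (is_derive_expm n t) Dw) (is_derive_expmN n t).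
  have := PW t; rewrite {1}EW => /(along_parallel (Eg t) DE) <-.
  exact: DE.
rewrite {1}EW; congr field_along; apply/funext => t.
rewrite (expv_unique t DE); congr expv.
by rewrite /E /w exp_geodesic0 scale0r oppr0 expm0 mul1mx mulmx1.
Qed.

End ClosedForm.

End Transport.

(** * Antisymmetry for the metric *)

Section Skew.
Context {R : realType} {N : nat} {g : {vspace 'M[R]_N}}.
Hypothesis g_br : forall x y, x \in g -> y \in g -> mxbr x y \in g.
Variables (L : {linear 'M[R]_N -> 'M[R]_N}) (b : {bilinear 'M[R]_N -> 'M[R]_N -> R^o}).
Hypothesis L_mem : forall x, x \in g -> L x \in g.
Hypothesis L_ad : forall x y, x \in g -> y \in g -> L (mxbr (L x) y) = mxbr (L x) (L y).
Hypothesis b_sym : forall x y, x \in g -> y \in g -> b x y = b y x.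
Hypothesis b_ad : forall c x y, c \in g -> x \in g -> y \in g ->
  b (mxbr c x) y = - b x (mxbr c y).
Hypothesis b_L : forall x y, x \in g -> y \in g -> b (L x) y = b x (L y).
Variables (beta0 : R) (m : 'M[R]_N -> 'M[R]_N -> R).
Hypothesis mE : forall x y, x \in g -> y \in g -> m x y = beta0 * b (x - L x) y.

Lemma psi_mem x : x \in g -> x - L x \in g.
Proof. by move=> xg; rewrite rpredB ?L_mem. Qed.

Lemma b_psi x y : x \in g -> y \in g -> b (x - L x) y = b x (y - L y).
Proof. by move=> xg yg; rewrite linearBl linearBr/= b_L. Qed.

Lemma psi_form_sym x y : x \in g -> y \in g -> m x y = m y x.
Proof.
by move=> xg yg; rewrite !mE// b_psi// b_sym// psi_mem.
Qed.

Lemma psi_form_linear k x y z : x \in g -> y \in g -> z \in g ->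
  m (k *: x + y) z = k * m x z + m y z.
Proof.
move=> xg yg zg; rewrite !mE ?rpredD ?memvZ// linearP/= opprD addrACA -scalerBr.
by rewrite linearPl mulrDr mulrCA.
Qed.

Lemma psi_form_bilinear : symmetric_bilinear g m.
Proof. by split=> [k x y z|x y]; [exact: psi_form_linear|exact: psi_form_sym]. Qed.

(** ad_(L x) is antisymmetric for the bi-invariant form and commutes with 1 - L. *)
Lemma psi_form_adL x y z : x \in g -> y \in g -> z \in g ->
  m (mxbr (L x) y) z + m y (mxbr (L x) z) = 0.
Proof.
move=> xg yg zg; have Lg := L_mem xg.
rewrite !mE ?g_br// L_ad// -linearBr b_ad ?psi_mem//.
by rewrite mulrN addNr.
Qed.

Lemma transport_op_psi V x : transport_op L V x = 2^-1 *: (mxbr (x - L x) V + mxbr (L V) x).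
Proof. by rewrite /transport_op linearBl/= addrAC. Qed.

(** Both terms are the trilinear form <u, [V, w]> evaluated at u = (1 - L) x and
    w = (1 - L) y, with opposite signs. *)
Lemma psi_form_swap V x y : V \in g -> x \in g -> y \in g ->
  m (mxbr (x - L x) V) y + m (mxbr (y - L y) V) x = 0.
Proof.
move=> Vg xg yg; have px := psi_mem xg; have py := psi_mem yg.
rewrite !mE ?g_br// !b_psi ?g_br// [mxbr (x - L x) V]mxbrC linearNl/= b_ad// opprK.
by rewrite [b (mxbr (y - L y) V) _]b_sym ?g_br// [mxbr (y - L y) V]mxbrC linearNr mulrN subrr.
Qed.

(** Each of the two brackets in [transport_op_psi] is antisymmetric on its own. *)
Lemma transport_op_skew V x y : V \in g -> x \in g -> y \in g ->
  m (transport_op L V x) y + m (transport_op L V y) x = 0.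
Proof.
move=> Vg xg yg; have px := psi_mem xg; have py := psi_mem yg; have LVg := L_mem Vg.
have mZ u v w : u \in g -> v \in g -> w \in g ->
    m (2^-1 *: (u + v)) w = 2^-1 * (m u w + m v w).
  move=> ug vg wg; have -> : 2^-1 *: (u + v) = 2^-1 *: (u + v) + 0 by rewrite addr0.
  rewrite psi_form_linear ?rpredD ?mem0v//.
  have -> : u + v = 1 *: u + v by rewrite scale1r.
  rewrite psi_form_linear// mul1r [m 0 w]mE ?mem0v// linear0 subrr linear0l mulr0.
  by rewrite addr0.
rewrite !transport_op_psi !mZ ?g_br// -mulrDr addrACA psi_form_swap// add0r.
by rewrite [m (mxbr (L V) y) x]psi_form_sym ?g_br// psi_form_adL// mulr0.
Qed.

(** S x is the difference of two antisymmetric operators, by [transport_opE]. *)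
Lemma conn_op_skew x y z : x \in g -> y \in g -> z \in g ->
  m (conn_op L x y) z + m y (conn_op L x z) = 0.
Proof.
move=> xg yg zg; have Lg := L_mem xg.
have pg u : u \in g -> transport_op L x u \in g.
  by move=> ug; rewrite transport_op_psi memvZ// rpredD ?g_br ?psi_mem.
have SE u : conn_op L x u = (-1) *: transport_op L x u + mxbr (L x) u.
  by rewrite transport_opE scaleN1r opprB subrK.
rewrite [m y _]psi_form_sym; last 2 first.
- by [].
- by rewrite SE; apply: rpredD; [apply/memvZ/pg|exact: g_br].
rewrite !SE !psi_form_linear ?pg ?g_br// addrACA !mulN1r -opprD transport_op_skew// oppr0 add0r.
by rewrite [m (mxbr (L x) z) y]psi_form_sym ?g_br// psi_form_adL.
Qed.

End Skew.

(** * The metric modified along a subgroup *)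

(** Makes it possible to replace an operator which is linear on h only by a linear
    one. *)
Lemma expv_ext (R : realType) (N : nat) (h : {vspace 'M[R]_N}) (P P' : 'M[R]_N -> 'M[R]_N) v :
  (forall C, C \in h -> P C = P' C) -> (forall C, C \in h -> P' C \in h) -> v \in h ->
  expv P v = expv P' v.
Proof.
move=> PP' P'h vh; congr (limn (series _)); apply/funext => k; congr (_ *: _).
suff [] : iter k P v = iter k P' v /\ iter k P' v \in h by [].
elim: k => [|k [IH IHh]] //=; split; last exact: P'h.
by rewrite IH PP'.
Qed.

Lemma lcGamma_expand (R : realType) (N : nat) (X xi eta p q : 'M[R]_N) :
  X \in unitmx ->
  X *m (2^-1 *: (mxbr (invmx X *m xi) (invmx X *m eta) + p + q) -
        invmx X *m xi *m (invmx X *m eta)) =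
  - (2^-1 *: (xi *m invmx X *m eta + eta *m invmx X *m xi)) + 2^-1 *: (X *m (p + q)).
Proof.
move=> UX; set y := invmx X *m xi; set z := invmx X *m eta.
have -> : xi *m invmx X *m eta = X *m (y *m z).
  by rewrite /y /z !mulmxA mulmxV// mul1mx.
have -> : eta *m invmx X *m xi = X *m (z *m y).
  by rewrite /y /z !mulmxA mulmxV// mul1mx.
transitivity (X *m (- (2^-1 *: (y *m z + z *m y)) + 2^-1 *: (p + q))); last first.
  by rewrite [LHS]mulmxDr mulmxN -!scalemxAr mulmxDr.
congr (_ *m _); rewrite /mxbr; move: (y *m z) (z *m y) => yz zy.
have {2}-> : yz = 2^-1 *: (yz + yz).
  by rewrite -[yz + yz]mulr2n -[yz *+ 2]scaler_nat scalerA mulVf ?scale1r ?pnatr_eq0.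
rewrite -scalerBr -scalerN -scalerDr; congr (_ *: _).
rewrite -(addrA _ p q) [_ + (p + q)]addrC -addrA [RHS]addrC; congr (_ + _).
by rewrite opprD addrACA subrr add0r opprD addrC.
Qed.

Theorem theorem2 (R : realType) (N : nat)
  (G : set 'M[R]_N) (g : {vspace 'M[R]_N})
  (HG : connected_lie_subgroup G g)
  (ip : 'M[R]_N -> 'M[R]_N -> R)
  (ip_bilin : symmetric_bilinear g ip)
  (ip_nondeg : nondegenerate_on g ip)
  (ip_inv : bi_invariant G g ip)
  (A : set 'M[R]_N) (a : {vspace 'M[R]_N})
  (HA : connected_lie_subgroup A a)
  (sAG : A `<=` G)
  (ip_nondeg_a : nondegenerate_on a ip)
  (B : 'M[R]_N -> 'M[R]_N)
  (B_itw : intertwining A a ip B)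
  (B_inv : set_bij [set` a] [set` a] B)
  (beta0 : R) (beta0_neq0 : beta0 != 0) :
  let metric := left_invariant_metric (form_beta a ip beta0 B) in
  let phi := IBP a ip beta0 B in
  let PV V C := 2^-1 *: (mxbr C V + mxbr (phi V) C - mxbr (phi C) V) in
  let gamma X xi (t : R) :=
    let V := invmx X *m xi in
    X *m expm (t *: (- phi V + V)) *m expm (t *: phi V) in
  [/\ exists nabla, levi_civita G g metric nabla,
      forall nabla, levi_civita G g metric nabla ->
        [/\ exists Gam, christoffel G g nabla Gam
          & forall Gam, christoffel G g nabla Gam ->
            [/\ (* Christoffel function *)
                forall X xi eta, G X -> tangent g X xi -> tangent g X eta ->
                  Gam X xi eta =
                  - (2^-1 *: (xi *m invmx X *m eta + eta *m invmx X *m xi))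
                  + 2^-1 *: (X *m (mxbr (phi (invmx X *m xi)) (invmx X *m eta)
                                 + mxbr (phi (invmx X *m eta)) (invmx X *m xi))),
                (* geodesics *)
                forall X xi, G X -> tangent g X xi ->
                  forall c : R -> 'M[R]_N,
                    [/\ geodesic G g Gam c, c 0 = X & derive1 c 0 = xi] <->
                    c =1 gamma X xi
              & (* parallel transport *)
                forall X xi eta, G X -> tangent g X xi -> tangent g X eta ->
                  let V := invmx X *m xi in
                  forall (t : R) (zeta : 'M[R]_N),
                    parallel_transport g Gam (gamma X xi) 0 t eta zeta <->
                    zeta = X *m expm (t *: (- phi V + V))
                             *m expv (fun C => t *: PV V C) (invmx X *m eta)
                             *m expm (t *: phi V)]]
    & forall V C D, V \in g -> C \in g -> D \in g ->
        form_beta a ip beta0 B (PV V C) D + form_beta a ip beta0 B (PV V D) C = 0].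
Proof.
move=> metric phi PV gamma.
have [b bE] := form_extension ip_bilin.
have phi_lin := phi_linear HG ip_bilin HA sAG ip_nondeg_a B_itw beta0.
have [L LE] := linear_extension phi_lin.
have ag := subvP (sub_lie_alg HG HA sAG).
have phi_a x : x \in g -> phi x \in a.
  exact: (phi_mem HG ip_bilin HA).
have phi_g x : x \in g -> phi x \in g by move=> xg; apply/ag/phi_a.
have L_mem x : x \in g -> L x \in g by move=> xg; rewrite LE// phi_g.
have g_br := lie_br HG.
have L_ad x y : x \in g -> y \in g -> L (mxbr (L x) y) = mxbr (L x) (L y).
  by move=> xg yg; rewrite !LE ?g_br ?phi_g//; apply: (phi_ad HG ip_bilin ip_inv HA) => //; exact: phi_a.
have L_Ad x y t : x \in g -> y \in g ->
    L (expm (t *: L x) *m y *m expm (- (t *: L x))) =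
    expm (t *: L x) *m L y *m expm (- (t *: L x)).
  move=> xg yg; have Ax : A (expm (t *: L x)).
    by apply: (lie_expm HA); rewrite memvZ// LE// phi_a.
  rewrite -invmx_expm LE; last by apply: (lie_Ad_mem HG) => //; exact: sAG.
  by rewrite (LE y)//; apply: (phi_Ad HG ip_bilin ip_inv HA).
have b_sym x y : x \in g -> y \in g -> b x y = b y x.
  by move=> xg yg; rewrite !bE// ip_bilin.2.
have b_ad c x y : c \in g -> x \in g -> y \in g -> b (mxbr c x) y = - b x (mxbr c y).
  by move=> cg xg yg; rewrite !bE ?g_br//; exact: (ip_ad HG).
have b_L x y : x \in g -> y \in g -> b (L x) y = b x (L y).
  move=> xg yg; rewrite !bE ?L_mem// !LE//.
  exact: (phi_selfadjoint HG ip_bilin HA sAG ip_nondeg_a B_itw).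
pose m := form_beta a ip beta0 B.
have mE x y : x \in g -> y \in g -> m x y = beta0 * b (x - L x) y.
  move=> xg yg; rewrite bE ?rpredB ?L_mem// LE//.
  exact: (form_betaE HG ip_bilin HA sAG).
have [mb mbE] := form_extension (psi_form_bilinear L_mem b_sym b_L mE).
have m_sym := psi_form_sym L_mem b_sym b_L mE.
have m_nondeg : nondegenerate_on g m.
  move=> x xg Hx; have psi0 : x - L x = 0.
    apply: ip_nondeg => [|y yg]; first by rewrite rpredB ?L_mem.
    have /eqP := Hx y yg; rewrite mE// mulf_eq0 (negbTE beta0_neq0)/= => /eqP.
    by rewrite bE ?rpredB ?L_mem.
  have [_ Binj _] := B_inv.
  apply: (phi_fix0 HG ip_bilin HA sAG ip_nondeg_a B_itw beta0_neq0 Binj) => //.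
  by rewrite -LE//; apply/eqP; rewrite eq_sym -subr_eq0; apply/eqP.
have S_mem := conn_op_mem HG L_mem.
have S_tor x y : x \in g -> y \in g -> conn_op L x y - conn_op L y x = mxbr x y.
  by move=> _ _; exact: conn_op_torsion.
have S_skew := conn_op_skew g_br L_mem L_ad b_sym b_ad b_L mE.
have LC : levi_civita G g metric (lcNabla (conn_op L)).
  exact: (lcNabla_levi_civita HG mbE S_mem S_tor S_skew).
have PVE V C : V \in g -> C \in g -> PV V C = transport_op L V C.
  by move=> Vg Cg; rewrite /PV /transport_op !LE.
split.
- by exists (lcNabla (conn_op L)).
- move=> nabla LCn.
  have nE Y Z X : vector_field G g Y -> vector_field G g Z -> G X ->
      nabla Y Z X = lcNabla (conn_op L) Y Z X.
    move=> FY FZ /mem_set GX.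
    exact: (levi_civita_unique HG mbE m_sym m_nondeg LCn LC).
  split; first by exists (lcGamma (conn_op L)) => Y Z FY FZ X /set_mem GX; rewrite nE.
  move=> Gam Hgam.
  have GamE X xi eta : G X -> tangent g X xi -> tangent g X eta ->
      Gam X xi eta = lcGamma (conn_op L) X xi eta.
    move=> GX [x xg <-] [y yg <-].
    have Fx := left_invariant_field HG xg; have Fy := left_invariant_field HG yg.
    have := Hgam _ _ Fx Fy X (mem_set GX).
    by rewrite nE// => /addrI.
  have VG X xi : G X -> tangent g X xi -> invmx X *m xi \in g.
    by move=> GX; move/(tangentP HG _ GX).
  have gammaE X xi : G X -> tangent g X xi -> gamma X xi = exp_geodesic L X (invmx X *m xi).
    by move=> GX Txi; rewrite /gamma /exp_geodesic LE ?VG.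
  split.
  + move=> X xi eta GX Tx Te; rewrite GamE// /lcGamma /conn_op !LE ?VG//.
    have UX := lie_unit HG GX; exact: lcGamma_expand.
  + move=> X xi GX Tx c; rewrite gammaE//; have Vg := VG _ _ GX Tx.
    have XV : X *m (invmx X *m xi) = xi by rewrite mulKVmx ?(lie_unit HG).
    split=> [[Gc c0 dc0]|/funext ->].
      by apply: (geodesic_unique HG L_ad GX GamE Gc c0); rewrite XV.
    split; [exact: (exp_geodesic_geodesic HG)|exact: exp_geodesic0|].
    by rewrite derive_exp_geodesic field_along0.
  + move=> X xi eta GX Tx Te V t zeta; have Vg := VG _ _ GX Tx.
    have eg := VG _ _ GX Te.
    have UX := lie_unit HG GX.
    rewrite gammaE// -/V.
    have -> : expv (fun C => t *: PV V C) (invmx X *m eta) =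
        expv (fun C => t *: transport_op L V C) (invmx X *m eta).
      apply: (expv_ext (h := g)) => // C Cg; first by rewrite PVE.
      by apply: memvZ; exact: (transport_op_mem HG).
    split=> [[W [PW W0 <-]]|->].
      rewrite (parallel_unique HG L_mem L_Ad GX Vg GamE PW) W0.
      by rewrite /field_along LE.
    exists (field_along L X V (fun s => expv (fun C => s *: transport_op L V C) (invmx X *m eta))).
    split; first exact: (parallel_exists HG).
      by rewrite field_along0 expv0 mulKVmx.
    by rewrite /field_along LE.
- move=> V C D Vg Cg Dg; rewrite !PVE//.
  exact: (transport_op_skew g_br L_mem L_ad b_sym b_ad b_L mE).
Qed.
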